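(* Let $d$ be a positive integer and let $\mathbb{F}_d$ be the free group on the generators $\{a_1,\dots,a_d\}$. Given $\Sigma\subseteq\{a_1^{\pm1},\dots,a_d^{\pm1}\}$ with $\Sigma\supseteq\{a_1,\dots,a_d\}$, let $S=\langle\Sigma\rangle^+$ be the submonoid of $\mathbb{F}_d$ generated by $\Sigma$, and let $\mathbf{G}=(G,\eta)$ be a receiving $S$-group. The following are equivalent: (i) $\mathbf{G}$ is a realization of the free $S$-group, i.e., $\mathbf{G}$ is isomorphic as an $S$-group to $\mathbf{F}_d=(\mathbb{F}_d,\iota)$, where $\iota\colon S\to\mathbb{F}_d$ is the inclusion. (ii) For every finite alphabet $\mathcal{A}$, every $S$-invariant measure in $\mathcal{M}(\mathcal{A}^S)$ is $\mathbf{G}$-extensible. (iii) For every finite alphabet $\mathcal{A}$, every fully supported $S$-invariant Markov measure in $\mathcal{M}(\mathcal{A}^S)$ is $\mathbf{G}$-extensible.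
   Context: $\langle\Sigma\rangle^+$ is the set of all finite products of elements of $\Sigma$, including the empty product $\varepsilon=1$. A receiving $S$-group is a pair $(G,\eta)$ with $G$ a group and $\eta\colon S\to G$ an injective semigroup morphism whose image generates $G$ as a group. An isomorphism of $S$-groups $(G,\eta)\to(G',\eta')$ is a group isomorphism $\theta$ with $\theta\circ\eta=\eta'$. The pair $(\mathbb{F}_d,\iota)$ is the free $S$-group, i.e. for every group $G'$ and semigroup morphism $\eta'\colon S\to G'$ with $\eta'(S)$ generating $G'$ there is a unique group morphism $\theta\colon\mathbb{F}_d\to G'$ with $\theta\circ\iota=\eta'$. For a finite set $\mathcal{A}$ (discrete alphabet), $\mathcal{A}^S$ has the product topology and shift action $(s\cdot x)(t)=x(ts)$, and likewise $G$ acts on $\mathcal{A}^G$ by $(g\cdot x)(h)=x(hg)$. $\mathcal{M}(\cdot)$ denotes Borel probability measures; $\mu$ is $S$-invariant if $\mu(s^{-1}A)=\mu(A)$ for all $s\in S$ and Borel $A$, where $s^{-1}A=\{x:s\cdot x\in A\}$ (similarly for $G$). $\mu$ is fully supported if its support is all of $\mathcal{A}^S$. An $S$-invariant $\mu\in\mathcal{M}(\mathcal{A}^S)$ is $\mathbf{G}$-extensible if there is a $G$-invariant $\bar\mu\in\mathcal{M}(\mathcal{A}^G)$ with $\pi_*\bar\mu=\mu$, where $\pi\colon\mathcal{A}^G\to\mathcal{A}^S$, $\pi(x)=x\circ\eta$. (The natural $\mathbf{G}$-extension of $\mathcal{A}^S$ is identified with $\mathcal{A}^G$ equipped with this map.)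 Markov measures. A Markov $\Sigma$-tree chain is a pair $(\mathbf{p},\mathbf{P})$ where $\mathbf{p}=(\mathbf{p}_k)_{k\in\mathcal{A}}$ is a probability vector with all entries positive and $\mathbf{P}=\{\mathbf{P}^a:a\in\Sigma\}$ is a family of $|\mathcal{A}|\times|\mathcal{A}|$ stochastic matrices (nonnegative entries, rows summing to 1). The Cayley graph $\mathrm{Cay}(S,\Sigma)$ has vertex set $S$ and edges joining $t$ to $at$ for $t\in S$, $a\in\Sigma$; it is a tree. A finite tree $T\subseteq S$ with root $\varepsilon$ is a finite subset containing $\varepsilon$ that induces a connected subgraph; $E(T)$ is its set of edges, each written $(t,at)$ with $a\in\Sigma$, oriented away from $\varepsilon$ (i.e. $at$ has larger distance to $\varepsilon$ than $t$). For $Q\subseteq S$ put $[x;Q]=\{y\in\mathcal{A}^S:y(t)=x(t)\ \forall t\in Q\}$. A measure $\mu\in\mathcal{M}(\mathcal{A}^S)$ is $(\mathbf{p},\mathbf{P})$-Markov if for every $x\in\mathcal{A}^S$ and every finite tree $T\subseteq S$ with root $\varepsilon$, $$\mu([x;T])=\mathbf{p}_{x(\varepsilon)}\prod_{(t,at)\in E(T)}\mathbf{P}^a_{x(t),x(at)},$$ and $\mu$ is Markov if it is $(\mathbf{p},\mathbf{P})$-Markov for some Markov $\Sigma$-tree chain $(\mathbf{p},\mathbf{P})$. *)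

(* Defs.v *)
From HB Require Import structures.
From mathcomp Require Import all_boot all_order all_algebra.
From mathcomp Require Import all_classical all_reals all_analysis.

Set Implicit Arguments.
Unset Strict Implicit.
Unset Printing Implicit Defensive.
Import Order.TTheory GRing.Theory Num.Theory.

Local Open Scope classical_set_scope.
Local Open Scope ring_scope.

(* The letter (i, b) stands for a_i if b = false and for a_i^-1 if b = true;
   the free group is realized as the set of reduced words. *)
Section FreeGroup.
Variable d : nat.

Local Notation letter := ('I_d * bool)%type.

Definition letter_inv (x : letter) : letter := (x.1, ~~ x.2).

Lemma letter_invK : involutive letter_inv.
Proof. by case=> i b; rewrite /letter_inv /= negbK. Qed.

Definition reduced (w : seq letter) : bool :=
  sorted (fun x y => y != letter_inv x) w.

Record free_group := FreeGroup {
  fg_word :> seq letter;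
  fg_reduced : reduced fg_word }.

HB.instance Definition _ := [isSub for fg_word].
HB.instance Definition _ := [Equality of free_group by <:].
HB.instance Definition _ := [Choice of free_group by <:].

Definition push (x : letter) (w : seq letter) : seq letter :=
  if w is y :: w' then if y == letter_inv x then w' else x :: w else [:: x].

Lemma reduced_push x w : reduced w -> reduced (push x w).
Proof.
case: w => [|y w] //= rw; case: ifPn => [_|yx]; first exact: path_sorted rw.
by rewrite /= yx.
Qed.

Lemma pushK x w : reduced w -> push x (push (letter_inv x) w) = w.
Proof.
case: w => [|y w] /=; first by rewrite eqxx.
rewrite letter_invK; case: ifPn => [/eqP ->|yx]; last by rewrite /= eqxx.
by case: w => [|z w] //= /andP[/negPf-> _].
Qed.

Definition wmul (u v : seq letter) : seq letter := foldr push v u.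

Lemma reduced_wmul u v : reduced v -> reduced (wmul u v).
Proof. by move=> rv; elim: u => //= x u; exact: reduced_push. Qed.

Lemma wmul_push x v w : reduced w ->
  wmul (push x v) w = push x (wmul v w).
Proof.
case: v => [|y v] //= rw; case: ifPn => [/eqP ->|//].
by rewrite pushK //; exact: reduced_wmul.
Qed.

Lemma wmulA u v w : reduced w -> wmul u (wmul v w) = wmul (wmul u v) w.
Proof. by move=> rw; elim: u => //= x u ->; rewrite wmul_push. Qed.

Lemma wmulw0 u : reduced u -> wmul u [::] = u.
Proof.
elim: u => // x u IH xu; rewrite /= IH; last exact: path_sorted xu.
by case: u xu {IH} => //= y u /andP[/negPf-> _].
Qed.

Definition winv (w : seq letter) : seq letter := rev (map letter_inv w).

Lemma winvK : involutive winv.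
Proof. by move=> w; rewrite /winv map_rev revK mapK//; exact: letter_invK. Qed.

Lemma reduced_winv w : reduced w -> reduced (winv w).
Proof.
rewrite /reduced /winv rev_sorted sorted_map; apply: sub_sorted => x y /=.
by rewrite letter_invK eq_sym.
Qed.

Lemma wmulVw w : wmul (winv w) w = [::].
Proof.
elim: w => //= x w IH.
by rewrite /winv /= rev_cons /wmul foldr_rcons /= letter_invK eqxx.
Qed.

Definition fg_one : free_group := @FreeGroup [::] isT.
Definition fg_mul (u v : free_group) : free_group :=
  FreeGroup (reduced_wmul u (fg_reduced v)).
Definition fg_inv (u : free_group) : free_group :=
  FreeGroup (reduced_winv (fg_reduced u)).

Lemma fg_mulA : associative fg_mul.
Proof. by move=> u v w; apply/val_inj/wmulA/fg_reduced. Qed.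
Lemma fg_mul1g : left_id fg_one fg_mul.
Proof. by move=> u; exact/val_inj. Qed.
Lemma fg_mulg1 : right_id fg_one fg_mul.
Proof. by move=> u; apply/val_inj/wmulw0/fg_reduced. Qed.
Lemma fg_mulVg : left_inverse fg_one fg_inv fg_mul.
Proof. by move=> u; apply/val_inj/wmulVw. Qed.
Lemma fg_mulgV : right_inverse fg_one fg_inv fg_mul.
Proof. by move=> u; apply/val_inj; rewrite /= -{1}[fg_word u]winvK wmulVw. Qed.

HB.instance Definition _ := isGroup.Build free_group
  fg_mulA fg_mul1g fg_mulg1 fg_mulVg fg_mulgV.

Definition fg_gen (i : 'I_d) : free_group := @FreeGroup [:: (i, false)] isT.

Lemma free_group_univ (G : groupType) (f : 'I_d -> G) :
  exists! phi : free_group -> G,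
    {morph phi : u v / (u * v)%g} /\ forall i, phi (fg_gen i) = f i.
Proof.
pose l (x : letter) : G := if x.2 then (f x.1)^-1%g else f x.1.
pose ev (w : seq letter) : G := foldr (fun x g => (l x * g)%g) 1%g w.
have lV x : (l x * l (letter_inv x) = 1)%g.
  by rewrite /l; case: x => i [] /=; rewrite ?mulVg ?mulgV.
have ev_push x w : ev (push x w) = (l x * ev w)%g.
  by case: w => [|y w] //=; case: ifP => //= /eqP ->; rewrite mulgA lV mul1g.
have evM u v : ev (wmul u v) = (ev u * ev v)%g.
  by elim: u => [|x u IH] /=; rewrite ?mul1g// ev_push IH mulgA.
exists (fun w : free_group => ev w); split.
  by split=> [u v|i]; [exact: evM | rewrite /= mulg1].
move=> phi [phiM phig]; apply/funext => -[w rw] /=.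
have phi1 : phi 1%g = 1%g.
  by apply: (mulgI (phi 1%g)); rewrite -phiM !mulg1.
elim: w rw => [|x w IH] rw /=.
  by rewrite -[LHS]phi1; congr phi; exact: val_inj.
have rw' : reduced w by exact: path_sorted rw.
have -> : FreeGroup rw = (@FreeGroup [:: x] isT * FreeGroup rw')%g.
  apply/val_inj => /=; case: {IH rw'} w rw => //= y w /andP[/negPf -> _] //.
rewrite phiM -(IH rw'); congr (_ * _)%g.
case: x {rw} => i []; rewrite /l /=; last by rewrite -phig; congr phi; exact: val_inj.
apply: (mulgI (f i)); rewrite mulgV -phig -phiM -phi1; congr phi.
by apply: val_inj; rewrite /= eqxx.
Qed.

End FreeGroup.

Section Submonoid.
Variables (M : monoidType) (Sigma : set M).

Definition products : set M :=
  [set x | exists2 s : seq M, (forall y, y \in s -> Sigma y) &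
                              x = (\prod_(y <- s) y)%g].

Definition submonoid : Type := {x : M | x \in products}.

HB.instance Definition _ := SubChoice.on submonoid.

Lemma products_monoid_closed : monoid_closed (mem products).
Proof.
split; first by rewrite inE; exists [::] => //; rewrite big_nil.
move=> x y; rewrite !inE => -[s hs ->] [t ht ->].
exists (s ++ t); last by rewrite big_cat.
by move=> z; rewrite mem_cat => /orP[/hs|/ht].
Qed.

HB.instance Definition _ :=
  SubChoice_isSubMonoid.Build M (mem products) submonoid products_monoid_closed.

Lemma sub_products (a : Sigma) : val a \in products.
Proof.
rewrite inE; exists [:: val a]; last by rewrite big_seq1.
by move=> y; rewrite inE => /eqP ->; exact: set_valP.
Qed.

Definition incl_gen (a : Sigma) : submonoid := Sub (val a) (sub_products a).

End Submonoid.

(* The point is there because measurableType requires it; it only rules out the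
   empty alphabet, for which A^I carries no probability measure (I nonempty). *)
#[short(type="pointedFinType")]
HB.structure Definition PointedFinite := {T of Finite T & Pointed T}.

(* A^I for a discrete alphabet A, with the product topology. *)
Definition config (I A : Type) : Type := I -> A.
HB.instance Definition _ (I : Type) (A : choiceType) :=
  Topological.copy (config I A) {ptws I -> discrete_topology A}.
HB.instance Definition _ (I : Type) (A : pointedType) :=
  isPointed.Build (config I A) (fun=> point).

Definition borel (T : ptopologicalType) : Type := g_sigma_algebraType (@open T).
HB.instance Definition _ (T : ptopologicalType) := Measurable.on (borel T).

Definition shift_act (M : magmaType) (A : Type) (s : M) (x : config M A) :
  config M A := fun t => x (t * s)%g.

Definition shift_invariant (R : realType) (M : magmaType) (A : pointedFinType)
    (mu : probability (borel (config M A)) R) : Prop :=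
  forall (s : M) (B : set (borel (config M A))), measurable B ->
    mu (@shift_act M A s @^-1` B) = mu B.

Definition msupport (R : realType) (T : ptopologicalType)
    (mu : probability (borel T) R) : set T :=
  [set x | forall U : set T, open U -> U x -> (0 < mu U)%E].

Definition fully_supported (R : realType) (T : ptopologicalType)
    (mu : probability (borel T) R) : Prop := msupport mu = setT.

(* The third clause says that the image of eta generates G as a group. *)
Definition receiving_group (S : monoidType) (G : groupType) (eta : S -> G) :
    Prop :=
  [/\ injective eta,
      {morph eta : s t / (s * t)%g} &
      forall H : {pred G}, group_closed H -> (forall s, eta s \in H) ->
        forall g, g \in H].

Definition sgroup_isomorphic (S : monoidType) (G G' : groupType)
    (eta : S -> G) (eta' : S -> G') : Prop :=
  exists theta : G -> G',
    [/\ {morph theta : g h / (g * h)%g}, bijective theta &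
        theta \o eta =1 eta'].

Lemma free_group_receiving (d : nat) (Sigma : set (free_group d)) :
  (forall i, Sigma (fg_gen i)) ->
  receiving_group (val : submonoid Sigma -> free_group d).
Proof.
move=> hgen; split; [exact: val_inj | exact: valM | move=> H Hc HS].
have HV := group_closedV Hc; have HM := group_closedM Hc.
have Hg i : fg_gen i \in H.
  have hi : fg_gen i \in Sigma by rewrite inE.
  exact: (HS (incl_gen (@exist _ (fun x => x \in Sigma) _ hi))).
case; elim=> [|x w IH] rw.
  by rewrite (_ : FreeGroup _ = 1%g) ?Hc.1//; exact: val_inj.
have rw' : reduced w by exact: path_sorted rw.
have -> : FreeGroup rw = (@FreeGroup d [:: x] isT * FreeGroup rw')%g.
  by apply/val_inj => /=; case: {IH rw'} w rw => //= y w /andP[/negPf -> _].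
apply: HM; last exact: IH.
case: x {rw} => i []; last by have := Hg i; congr (_ \in H); exact: val_inj.
by have := HV _ (Hg i); congr (_ \in H); exact: val_inj.
Qed.

Definition restriction (S G A : Type) (eta : S -> G)
  (x : config G A) : config S A := x \o eta.

Definition extensible (R : realType) (S : monoidType) (G : groupType)
    (eta : S -> G) (A : pointedFinType)
    (mu : probability (borel (config S A)) R) : Prop :=
  exists nu : probability (borel (config G A)) R,
    shift_invariant nu /\
    forall B : set (borel (config S A)), measurable B ->
      pushforward nu
        (restriction eta : borel (config G A) -> borel (config S A)) B = mu B.

Section Markov.
Variables (M : monoidType) (Sigma : set M).
Local Notation S := (submonoid Sigma).

Definition cayley : rel S := fun t u =>
  `[< exists a : Sigma,
        u = (incl_gen a * t)%g \/ t = (incl_gen a * u)%g >].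

Definition cayley_walk (t u : S) (n : nat) : Prop :=
  exists p : seq S, [/\ path cayley t p, last t p = u & size p = n].

Lemma cayley_walk_from_1 (t : S) : exists n, `[< cayley_walk 1%g t n >].
Proof.
have [s hs ts] : products Sigma (val t) by apply/set_mem/(valP t).
elim: s hs t ts => [|y s IH] hs t ts.
  exists 0%N; apply/asboolP; exists [::]; split=> //=.
  by apply: val_inj; rewrite /= ts big_nil.
have hs' z : z \in s -> Sigma z by move=> zs; apply: hs; rewrite inE zs orbT.
have us : (\prod_(z <- s) z)%g \in products Sigma by rewrite inE; exists s.
pose u : S := @exist M (fun x => x \in products Sigma) _ us.
have [n /asboolP[p [pp lp sp]]] := IH hs' u erefl.
exists n.+1; apply/asboolP; exists (rcons p t).
rewrite rcons_path last_rcons size_rcons pp sp lp; split=> //=.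
have ySigma : y \in Sigma by rewrite inE; apply: hs; rewrite mem_head.
apply/asboolP; exists (@exist M (fun x => x \in Sigma) y ySigma); left; apply: val_inj.
by rewrite ts big_cons valM.
Qed.

(* Graph distance to the identity. *)
Definition cayley_depth (t : S) : nat := ex_minn (cayley_walk_from_1 t).

Definition rooted_tree (T : set S) : Prop :=
  [/\ finite_set T, T 1%g &
      forall t u, T t -> T u -> exists p : seq S,
        [/\ path cayley t p, last t p = u & [set` p] `<=` T]].

(* (t, a) stands for the edge joining t to a t, oriented away from the root; if
   M is cancellative, distinct pairs give distinct undirected edges. *)
Definition tree_edges (T : set S) : set (S * Sigma) :=
  [set e | [/\ T e.1, T (incl_gen e.2 * e.1)%g &
      (cayley_depth e.1 < cayley_depth (incl_gen e.2 * e.1)%g)%N]].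

Definition markov_tree_chain (R : realType) (A : finType)
    (p : A -> R) (P : Sigma -> A -> A -> R) : Prop :=
  [/\ forall k, 0 < p k,
      \sum_k p k = 1,
      forall a k l, 0 <= P a k l &
      forall a k, \sum_l P a k l = 1].

Definition cylinder (A : Type) (x : config S A) (Q : set S) :
    set (config S A) :=
  [set y | forall t, Q t -> y t = x t].

Definition chain_markov (R : realType) (A : pointedFinType)
    (p : A -> R) (P : Sigma -> A -> A -> R)
    (mu : probability (borel (config S A)) R) : Prop :=
  forall (x : config S A) (T : set S), rooted_tree T ->
    mu (cylinder x T) =
      (p (x 1%g) *
       \big[*%R/1]_(e \in tree_edges T)
          P e.2 (x e.1) (x (incl_gen e.2 * e.1)%g))%:E.

Definition markov_measure (R : realType) (A : pointedFinType)
    (mu : probability (borel (config S A)) R) : Prop :=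
  exists (p : A -> R) (P : Sigma -> A -> A -> R),
    markov_tree_chain p P /\ chain_markov p P mu.

End Markov.

(* Main.v *)
From HB Require Import structures.
Require Import Defs.
From mathcomp Require Import all_boot all_order all_algebra.
From mathcomp Require Import all_classical all_reals all_analysis.
From mathcomp Require Import perm ring.

(** The free group acts on its left Cayley graph, a tree whose vertices are the
    reduced words, the parent of a word being its tail. Everything rests on one
    construction on that tree: a Markov chain indexed by its vertices, with a
    finite state space, a stationary law [p] and transition matrices [P l]
    along the letters [l], such that [P (letter_inv l)] is the time reversal of
    [P l]. Translating the chain by a letter moves the root across one edge,
    and reversibility says that the weight of a cylinder does not notice; so
    the law of the chain is invariant ([invariant_tree_chain]).

    From the free group to extensibility ([free_group_extensible]). If
    inverses of a measure preserving action are not available one can still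
    choose preimages at random: run the tree chain whose state at a vertex is a
    whole configuration on S, where the edge of the generator a_i carries the
    joint law of x and a_i x under mu. Both marginals of that law are mu, by
    invariance, so the chain is stationary and its law invariant; and along S
    the transitions are forced, so that reading the state at the root of S
    returns mu. To stay with finite state spaces, configurations are only
    remembered on the first n elements of S. The resulting invariant measures
    on A^F_d agree with mu on more and more coordinates of S as n grows, and a
    limit of them along an ultrafilter is the extension ([limit_measure]). The
    limit exists as a measure because finitely additive functions on the
    algebra of clopen sets of a compact space are countably additive
    ([kolmogorov_extension]); the same argument produces the chains
    themselves.

    From extensibility to the free group ([iso_of_extensible]). The morphism
    theta from the free group to G that agrees with eta on S is onto; suppose
    that it kills a reduced word w of positive length n. Free groups are
    residually finite: there are permutations s_i of n + 1 points such that w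
    acts nontrivially ([free_group_residual]). Let the state follow s_i along
    a_i, except for a noise of probability less than 1 / (n + 1)^2. The
    restriction to S of this reversible chain is an invariant, fully supported
    Markov measure. In an extension to A^G, the state at theta w would be the
    image by w of the state at 1 up to n slips; but theta w = 1, so one of the
    slips has to happen whenever the state at 1 is moved by w, an event of
    probability at least 1 / (n + 1), more than the n slips can account for
    ([not_extensible_of_kernel]). *)

Set Implicit Arguments.
Unset Strict Implicit.
Unset Printing Implicit Defensive.
Import Order.TTheory GRing.Theory Num.Theory.
Import numFieldNormedType.Exports.

Local Open Scope classical_set_scope.
Local Open Scope ring_scope.

(** * Finitary sets of configurations *)

Section FiniteDependence.
Variables (I : choiceType) (A : pointedFinType).
Implicit Types (x y : config I A) (F : seq I) (C D : set (config I A)).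

Definition cyl x F : set (config I A) :=
  [set y : config I A | forall i, i \in F -> y i = x i].

(** Over a finite alphabet the sets that depend on finitely many coordinates
    are exactly the clopen ones; they form the algebra on which measures are
    built and compared. *)
Definition depends_on F C :=
  forall x y, (forall i, i \in F -> x i = y i) -> C x -> C y.

Definition finitary C := exists F, depends_on F C.

Lemma depends_on_sub F F' C :
  {subset F <= F'} -> depends_on F C -> depends_on F' C.
Proof. by move=> sFF' dC x y xy; apply: dC => i /sFF'; exact: xy. Qed.

Lemma depends_onE F C x y : depends_on F C ->
  (forall i, i \in F -> x i = y i) -> C x <-> C y.
Proof.
by move=> dC xy; split; [exact: dC | apply: dC => i iF; rewrite xy].
Qed.

Lemma finitary_setC C : finitary C -> finitary (~` C).
Proof.
move=> [F dC]; exists F => x y xy nCx Cy; apply: nCx.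
by rewrite (depends_onE dC xy).
Qed.

Lemma finitary_setU C D : finitary C -> finitary D -> finitary (C `|` D).
Proof.
move=> [F dC] [F' dD]; exists (F ++ F') => x y xy [Cx|Dx]; [left|right].
  by apply: dC Cx => i iF; apply: xy; rewrite mem_cat iF.
by apply: dD Dx => i iF; apply: xy; rewrite mem_cat iF orbT.
Qed.

Lemma finitary_setT : finitary setT. Proof. by exists [::]. Qed.

Lemma finitary_set0 : finitary set0. Proof. by exists [::]. Qed.

Lemma finitary_setI C D : finitary C -> finitary D -> finitary (C `&` D).
Proof.
move=> fC fD; rewrite -[C `&` D]setCK setCI.
by apply/finitary_setC/finitary_setU; exact: finitary_setC.
Qed.

Lemma cyl_depends_on x F : depends_on F (cyl x F).
Proof. by move=> y z yz xy i iF; rewrite -yz// xy. Qed.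

Lemma finitary_cyl x F : finitary (cyl x F).
Proof. by exists F; exact: cyl_depends_on. Qed.

Lemma finitary_coord i (B : set A) : finitary [set x : config I A | B (x i)].
Proof. by exists [:: i] => x y xy /=; rewrite xy// mem_head. Qed.

Lemma nbhs_cyl x F : nbhs x (cyl x F).
Proof.
elim: F => [|i F IH]; first by apply: filterS filterT => y _ i; rewrite in_nil.
have : nbhs x ((fun y : config I A => y i) @^-1` [set x i]).
  apply: (@proj_continuous I (fun=> discrete_topology A) i x).
  exact: discrete_set1.
move/(filterI IH); apply: filterS => y [yF yi] j.
by rewrite inE => /predU1P[->|/yF].
Qed.

Lemma finitary_open C : finitary C -> open C.
Proof.
move=> [F dC]; rewrite openE => x Cx; apply: filterS (nbhs_cyl x F) => y yx.
by apply: dC Cx => i iF; rewrite yx.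
Qed.

(** The filter generated by the cylinders around [x] converges to [x] in each
    coordinate, hence in the product topology: it contains the neighbourhoods
    of [x]. *)
Lemma nbhs_finitary x (U : set (config I A)) :
  nbhs x U -> exists F, cyl x F `<=` U.
Proof.
pose N : set_system (config I A) := filter_from setT (cyl x).
have FN : Filter N.
  apply: filter_from_filter; first by exists [::].
  move=> F F' _ _; exists (F ++ F') => // y yF.
  by split=> i iF; apply: yF; rewrite mem_cat iF ?orbT.
have : {ptws, N --> (x : {ptws I -> discrete_topology A})}.
  apply/cvg_sup => i W; rewrite nbhsE => -[V [[B _ <-] xB] VW].
  exists [:: i] => // y yi; apply: VW => /=.
  by rewrite [y i]yi ?mem_head.
by move=> + nU => /(_ U nU) [F _ FU]; exists F.
Qed.

Lemma compact_config : compact [set: config I A].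
Proof.
have := @tychonoff I (fun=> discrete_topology A) (fun=> setT) (fun=> _).
rewrite (_ : [set f | _] = setT); last by apply/seteqP; split.
by apply=> _; apply: finite_compact; exact: finite_finset.
Qed.

Lemma compact_finitary C : finitary C -> compact C.
Proof.
move=> fC; apply: subclosed_compact compact_config _ => //.
by rewrite -[C]setCK; apply: open_closedC; apply/finitary_open/finitary_setC.
Qed.

End FiniteDependence.

(** * The Borel structure of a countable configuration space *)

Definition enumerates (I : Type) (e : nat -> I) := forall i, exists n, e n = i.

Lemma mem_mkseq_enum (I : eqType) (e : nat -> I) n j :
  (j < n)%N -> e j \in mkseq e n.
Proof. by move=> jn; apply/map_f; rewrite mem_iota. Qed.

Lemma enumerates_seq (I : eqType) (e : nat -> I) : enumerates e ->
  forall F : seq I, exists n, {subset F <= mkseq e n}.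
Proof.
move=> se; elim=> [|i F [n Fn]]; first by exists 0%N.
have [k <-] := se i; exists (maxn k.+1 n) => j.
rewrite inE => /predU1P[->|/Fn /mapP[l]].
  by apply: mem_mkseq_enum; rewrite leq_max leqnn.
by rewrite mem_iota => /= ln ->; apply: mem_mkseq_enum; rewrite leq_max ln orbT.
Qed.

Lemma enumerates_near (I : eqType) (e : nat -> I) : enumerates e ->
  forall F : seq I, \forall n \near \oo, {subset F <= mkseq e n}.
Proof.
move=> se F; have [N FN] := enumerates_seq se F; exists N => // n /= Nn i /FN.
case/mapP => k; rewrite mem_iota => /= kN ->.
exact/mem_mkseq_enum/(leq_trans kN).
Qed.

Lemma finitary_measurable (I : choiceType) (A : pointedFinType)
  (C : set (borel (config I A))) : @finitary I A C -> measurable C.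
Proof. by move=> /finitary_open oC; exact: sub_sigma_algebra. Qed.

Section BorelConfig.
Variables (I : choiceType) (A : pointedFinType) (e : nat -> I).
Hypothesis se : enumerates e.
Local Notation cfg := (borel (config I A)).

(** An open set [U] is the countable union over [n] of the sets of points whose
    cylinder over the first [n] coordinates lies in [U]; these are finitary. *)
Lemma measurable_finitaryE :
  (@measurable _ cfg : set (set (config I A))) = <<s @finitary I A >>.
Proof.
apply/seteqP; split; last first.
  by apply: sub_sigma_algebra2 => C; exact: finitary_open.
apply: smallest_sub; first exact: smallest_sigma_algebra.
move=> U oU; pose V n := [set x : config I A | cyl x (mkseq e n) `<=` U].
have -> : U = \bigcup_n V n.
  apply/seteqP; split => [x Ux|x [n _]]; last by apply.
  have [F FU] := nbhs_finitary (open_nbhs_nbhs (conj oU Ux)).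
  have [n Fn] := enumerates_seq se F.
  by exists n => // y yx; apply: FU => i /Fn; exact: yx.
apply: sigma_algebra_bigcup => n; apply: sub_sigma_algebra.
exists (mkseq e n) => x y xy Vx z zy.
by apply: Vx => i iF; rewrite zy// xy.
Qed.

Lemma probability_eq_finitary (R : realType) (mu nu : probability cfg R) :
  (forall C, @finitary I A C -> mu C = nu C) ->
  forall B, measurable B -> mu B = nu B.
Proof.
move=> mn B; apply: (@measure_unique _ R cfg (@finitary I A) (fun=> setT) _ _ _ _ mu nu).
- exact: measurable_finitaryE.
- by move=> C D; exact: finitary_setI.
- by move=> _; exact: finitary_setT.
- by rewrite bigcup_const.
- exact: mn.
- by move=> _ /=; rewrite probability_setT ltry.
Qed.

Lemma measurable_fun_finitary d (T : measurableType d) (f : T -> cfg) :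
  (forall C, @finitary I A C -> measurable (f @^-1` C)) ->
  measurable_fun setT f.
Proof.
move=> mf; apply: (@measurability _ _ T cfg setT f (@finitary I A)).
  exact: measurable_finitaryE.
by move=> _ [C fC <-]; rewrite setTI; exact: mf.
Qed.

End BorelConfig.

Section PushProbability.
Context d d' (T : measurableType d) (T' : measurableType d') (R : realType).
Variables (mu : probability T R) (f : T -> T') (mf : measurable_fun setT f).

Lemma push_probability : exists nu : probability T' R,
  forall B, nu B = mu (f @^-1` B).
Proof.
pose X : {mfun T >-> T'} := HB.pack f (isMeasurableFun.Build _ _ _ _ f mf).
by exists (distribution mu X).
Qed.

End PushProbability.

(** * Extension of finitely additive functions to measures *)

(** A copy of the configuration space whose measurable sets are the finitary
    ones: the starting point of the extension of a content by its outer
    measure. *)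
Definition finitary_space (I : choiceType) (A : pointedFinType) : Type :=
  config I A.

HB.instance Definition _ (I : choiceType) (A : pointedFinType) :=
  Pointed.copy (finitary_space I A) (config I A).

HB.instance Definition _ (I : choiceType) (A : pointedFinType) :=
  @isAlgebraOfSets.Build default_measure_display (finitary_space I A)
    (@finitary I A) (@finitary_set0 I A) (@finitary_setU I A) (@finitary_setC I A).

Section Kolmogorov.
Variables (R : realType) (I : choiceType) (A : pointedFinType) (e : nat -> I).
Hypothesis se : enumerates e.
Variable m : set (config I A) -> R.
Hypothesis m_ge0 : forall C, 0 <= m C.
Hypothesis mU : forall C D, finitary C -> finitary D -> C `&` D = set0 ->
  m (C `|` D) = m C + m D.
Hypothesis mT : m setT = 1.

Definition finitary_content (C : set (finitary_space I A)) : \bar R := (m C)%:E.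

Let finitary_content_ge0 C : (0 <= finitary_content C)%E.
Proof. by rewrite lee_fin m_ge0. Qed.

Let finitary_content0 : finitary_content set0 = 0%E.
Proof.
congr EFin; apply: (@addrI _ (m set0)).
by rewrite addr0 -mU ?setU0 ?setI0//; exact: finitary_set0.
Qed.

Let finitary_content_additive : measure_function.semi_additive finitary_content.
Proof.
apply/additive2P; first exact: finitary_content0.
by move=> C D fC fD CD; rewrite /finitary_content mU.
Qed.

HB.instance Definition _ := isContent.Build _ (finitary_space I A) R finitary_content
  finitary_content_ge0 finitary_content_additive.

Let finitary_content_sigma_subadditive :
  measurable_subset_sigma_subadditive finitary_content.
Proof.
move=> C F mF mC CF.
have := compact_finitary mC; rewrite compact_cover => /(_ nat setT F).
case=> [i _||D _ CD]; [exact/finitary_open/mF| exact: CF |].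
pose n := (\max_(k <- finmap.enum_fset D) k).+1.
have Dn k : k \in finmap.enum_fset D -> (k < n)%N.
  by move=> kD; rewrite ltnS; exact: (@leq_bigmax_seq _ _ xpredT id).
have : (finitary_content C <= \sum_(k < n) finitary_content (F k))%E.
  apply: content_subadditive => // x /CD [k kD Fx].
  by rewrite -bigcup_mkord; exists k => //=; exact: Dn.
move/le_trans; apply.
rewrite -(big_mkord xpredT (fun k => finitary_content (F k))).
exact: nneseries_lim_ge.
Qed.

HB.instance Definition _ := Content_SigmaSubAdditive_isMeasure.Build _ R
  (finitary_space I A) finitary_content finitary_content_sigma_subadditive.

(** A finitary set is compact and finitary sets are open, so a countable cover
    has a finite subcover: countable subadditivity of [m] is finite
    subadditivity, and the outer measure of [m] does the rest. *)
Theorem kolmogorov_extension : exists nu : probability (borel (config I A)) R,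
  forall C, finitary C -> nu C = (m C)%:E.
Proof.
pose T0 := g_sigma_algebraType (@measurable _ (finitary_space I A)).
pose M : measure T0 R := measure_extension finitary_content.
have ME C : finitary C -> M C = (m C)%:E.
  by move=> fC; rewrite /M /= /measure_extension measurable_mu_extE.
have MT : M setT = 1%E by rewrite ME ?mT//; exact: finitary_setT.
pose P : probability T0 R := mnormalize M (dirac point).
have PE B : P B = M B.
  by rewrite /P /= /mnormalize MT onee_eq0 /= invr1 mule1.
have idm : measurable_fun (setT : set T0) (idfun : T0 -> borel (config I A)).
  apply: (measurable_fun_finitary se) => C fC.
  by rewrite preimage_id; exact: sub_sigma_algebra.
have [nu nuE] := push_probability P idm.
by exists nu => C fC; rewrite nuE PE; exact: ME.
Qed.

End Kolmogorov.

(** * Limits of sequences of measures *)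

(** The image filter has a cluster point by compactness of [0, 1], and a cluster
    point of an ultrafilter is a limit. *)
Lemma cvg_ultra_bounded (R : realType) (U : set_system nat) (u : nat -> R) :
  UltraFilter U -> (forall n, 0 <= u n <= 1) -> cvg (u @ U).
Proof.
move=> UU u01; have := @segment_compact R 0 1.
have Fu : ProperFilter (u @ U) by exact: fmap_proper_filter.
move=> /(_ (u @ U) Fu) [|l [_ cl]].
  by apply: (@filterS _ U _ setT) filterT => n _ /=; rewrite in_itv; exact: u01.
apply/cvg_ex; exists l => V Vl.
have [//|UnV] := in_ultra_setVsetC (u @^-1` V) UU.
by have [x [? Vx]] := cl (~` V) V UnV Vl.
Unshelve. all: by end_near. Qed.

Section LimitMeasure.
Variables (R : realType) (I : choiceType) (A : pointedFinType) (e : nat -> I).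
Hypothesis se : enumerates e.
Variable m : nat -> set (config I A) -> R.
Hypothesis m_ge0 : forall n C, finitary C -> 0 <= m n C.
Hypothesis mU : forall n C D, finitary C -> finitary D -> C `&` D = set0 ->
  m n (C `|` D) = m n C + m n D.
Hypothesis mT : forall n, m n setT = 1.

(** The measure of [C] is the limit of [m n C] along a fixed ultrafilter, chosen
    once for all sets so that relations between the values persist. The two
    conclusions are the only ones that do not depend on the ultrafilter:
    eventual values and eventual equalities. *)
Theorem limit_measure : exists nu : probability (borel (config I A)) R,
  (forall C c, finitary C -> (\forall n \near \oo, m n C = c) ->
     nu C = c%:E) /\
  (forall C D, finitary C -> finitary D ->
     (\forall n \near \oo, m n C = m n D) -> nu C = nu D).
Proof.
have [U [UU UF]] := @ultraFilterLemma nat \oo _.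
have PU : ProperFilter U by exact: ultra_proper.
have m01 n C : finitary C -> 0 <= m n C <= 1.
  move=> fC; have fC' := finitary_setC fC.
  rewrite m_ge0//= -(mT n) -(setUv C) mU ?setICr// lerDl.
  exact: m_ge0.
have cm C : finitary C -> cvg (m ^~ C @ U).
  by move=> fC; apply: cvg_ultra_bounded => n; exact: m01.
pose l (C : set (config I A)) : R := if `[< finitary C >] then lim (m ^~ C @ U) else 0.
have lE C : finitary C -> m ^~ C @ U --> l C.
  by move=> fC; rewrite /l; case: asboolP => // _; exact: cm.
have lim_uniq (u : nat -> R) (a b : R) : u @ U --> a -> u @ U --> b -> a = b.
  move=> ua ub; rewrite -(cvg_lim (@norm_hausdorff R R) ua).
  exact: (cvg_lim (@norm_hausdorff R R) ub).
have [|C D fC fD CD||nu nuE] := @kolmogorov_extension R I A e se l.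
- move=> C; rewrite /l; case: asboolP => // fC.
  by apply: limr_ge; [exact: cm | near=> n; exact: m_ge0].
- apply: lim_uniq (lE _ (finitary_setU fC fD)) _ => //.
  rewrite (_ : m ^~ _ = fun n => m n C + m n D).
    by apply: cvgD; exact: lE.
  by apply/funext => n; exact: mU.
- apply: lim_uniq (lE _ (@finitary_setT I A)) _ => //.
  by rewrite (_ : m ^~ _ = cst 1); [exact: cvg_cst | exact/funext].
exists nu; split=> [C c fC mc|C D fC fD CD]; rewrite !nuE//; congr EFin.
- apply: lim_uniq (lE _ fC) _ => //.
  by apply: cvg_near_cst; apply: UF; exact: mc.
- apply: lim_uniq (lE _ fC) _ => //.
  apply: cvg_trans (lE _ fD); apply: near_eq_cvg.
  by apply: UF; apply: filterS CD => n ->.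
Unshelve. all: by end_near. Qed.

End LimitMeasure.

(** * Cylinders and coordinatewise maps *)

Lemma measure_sum_fibers d (T : measurableType d) (R : realType)
    (mu : {measure set T -> \bar R}) (E : finType) (g : T -> E) (C : set T) :
  (forall a, measurable (g @^-1` [set a])) -> measurable C ->
  mu C = (\sum_(a : E) mu (C `&` g @^-1` [set a]))%E.
Proof.
move=> mg mC; have -> : C = \bigcup_(a in [set` index_enum E]) (C `&` g @^-1` [set a]).
  apply/seteqP; split=> [x Cx|x [a _ []]//].
  by exists (g x) => //=; rewrite mem_index_enum.
rewrite measure_fin_bigcup//.
- rewrite -fsbig_seq ?index_enum_uniq//.
  apply: eq_bigr => a _; congr (mu _); apply/seteqP; split=> x /=.
    by move=> [Cx ax]; split=> //; exists a => //=; rewrite mem_index_enum.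
  by move=> [[b _ [Cx _]] ax].
- apply/trivIsetP => a b _ _ /eqP ab; rewrite -subset0 => x [[_ xa] [_ xb]].
  by apply: ab; rewrite -xa -xb.
- by move=> a _; exact: measurableI.
Qed.

Section CylinderUnique.
Variables (R : realType) (I : choiceType) (A : pointedFinType).
Local Notation cfg := (borel (config I A)).

Lemma measurable_coord_fiber (i : I) (a : A) :
  measurable ((fun x : cfg => x i) @^-1` [set a]).
Proof. by apply: finitary_measurable; exact: (@finitary_coord I A i [set a]). Qed.

(** A finitary set is a finite disjoint union of cylinders over any large enough
    finite set of coordinates; the induction splits along one coordinate at a
    time. *)
Lemma probability_eq_cyl (mu nu : probability cfg R) (Q : seq I -> Prop) :
  (forall F : seq I, exists F', Q F' /\ {subset F <= F'}) ->
  (forall x F, Q F -> mu (cyl x F) = nu (cyl x F)) ->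
  forall C, @finitary I A C -> mu C = nu C.
Proof.
move=> cofQ mn C [F0 dC0]; have [F [QF /depends_on_sub sub]] := cofQ F0.
have {dC0 sub}dC : depends_on F C by exact: sub.
suff H G (D : set (config I A)) : finitary D ->
    (forall x, mu (D `&` cyl x G) = nu (D `&` cyl x G)) -> mu D = nu D.
  apply: (H F) => [|x]; first by exists F.
  have [Cx|nCx] := pselect (C x).
    rewrite setIidr ?mn// => y yx; apply: dC Cx => i /yx.
    by move=> ->.
  rewrite (_ : _ `&` _ = set0) ?measure0// -subset0 => y [Cy yx].
  by apply: nCx; apply: dC Cy.
elim: G D => [|i G IH] D fD mD.
  have := mD point; rewrite (_ : _ `&` _ = D)//.
  by apply/seteqP; split=> [y []|y Dy]//; split.
have mD' : measurable (D : set cfg) by exact: finitary_measurable.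
rewrite !(measure_sum_fibers _ (measurable_coord_fiber i) mD').
apply: eq_bigr => a _; apply: IH => [|x].
  exact: finitary_setI fD (@finitary_coord I A i [set a]).
pose x' j := if j == i then a else x j.
have [xi|xi] := pselect (i \in G -> x i = a).
  rewrite (_ : _ `&` _ = D `&` cyl x' (i :: G)); first exact: mD.
  apply/seteqP; split=> y.
    move=> [[Dy ya] yG]; split=> // j; rewrite inE /x'.
    by case: eqVneq => [->//|_ /=]; exact: yG.
  move=> [Dy yG]; have ya : y i = a by rewrite yG ?mem_head// /x' eqxx.
  split=> // j jG; rewrite yG ?inE ?jG ?orbT// /x'.
  by case: eqVneq jG => // -> /xi.
rewrite (_ : _ `&` _ = set0) ?measure0// -subset0 => y [[_ ya] yG].
by apply: xi => iG; rewrite -yG.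
Qed.

End CylinderUnique.

(** Shifts, restrictions and changes of alphabet all have this form: the
    coordinate [j] of the image only reads the coordinate [k j]. *)
Section Coordinatewise.
Variables (I J : choiceType) (A B : pointedFinType).
Variables (phi : config I A -> config J B) (k : J -> I) (f : J -> A -> B).
Hypothesis phiE : forall x j, phi x j = f j (x (k j)).

Lemma finitary_preimage C : finitary C -> finitary (phi @^-1` C).
Proof.
move=> [F dC]; exists (map k F) => x y xy; apply: dC => j jF.
by rewrite !phiE xy//; exact: map_f.
Qed.

Lemma measurable_coordinatewise (e : nat -> J) : enumerates e ->
  measurable_fun setT (phi : borel (config I A) -> borel (config J B)).
Proof.
move=> se; apply: (measurable_fun_finitary se) => C fC.
by apply: finitary_measurable; exact: finitary_preimage.
Qed.

End Coordinatewise.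

(** * Reversible Markov chains on the tree of a free group *)

Section FreeGroupTree.
Variable d : nat.
Local Notation letter := ('I_d * bool)%type.
Local Notation Fd := (free_group d).

Lemma reduced_behead (w : seq letter) : reduced w -> reduced (behead w).
Proof. by case: w => //= x w; exact: path_sorted. Qed.

Definition fg_parent (w : Fd) : Fd :=
  FreeGroup (reduced_behead (fg_reduced w)).

Definition fg_letter (a : letter) : Fd := @FreeGroup d [:: a] isT.

Lemma fg_letterV a : (fg_letter a)^-1%g = fg_letter (letter_inv a).
Proof. exact: val_inj. Qed.

Lemma fg_letterKV a : (fg_letter (letter_inv a) * fg_letter a = 1)%g.
Proof. by rewrite -fg_letterV mulVg. Qed.

Lemma fg_parentM (w : Fd) l w' : fg_word w = l :: w' ->
  w = (fg_letter l * fg_parent w)%g.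
Proof.
move=> we; apply/val_inj; rewrite /= we /=.
have := fg_reduced w; rewrite we.
by case: {we} w' => //= y w' /andP[/negPf-> _].
Qed.

Lemma fg_ind (Q : Fd -> Prop) : Q 1%g ->
  (forall l w, Q w -> Q (fg_letter l * w)%g) -> forall w, Q w.
Proof.
move=> Q1 QM [w]; elim: w => [|l w IH] rw.
  by rewrite (_ : FreeGroup rw = 1%g)//; exact: val_inj.
by rewrite (@fg_parentM (FreeGroup rw) l w)//; apply: QM; exact: IH.
Qed.

(** Right multiplication by [a] modifies a reduced word at its right end, so the
    first letter [l] survives unless it is the letter that [a] cancels. *)
Lemma push_wmul_letter (l a : letter) (w : seq letter) :
  reduced (l :: w) -> l :: w != [:: letter_inv a] ->
  push l (wmul w [:: a]) = l :: wmul w [:: a].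
Proof.
elim: w l => [|y w IH] l /= rw la.
  by case: eqP => // al; rewrite al letter_invK eqxx in la.
have [yl ryw] : y != letter_inv l /\ reduced (y :: w) by apply/andP.
have [[-> ->] /=|yw] := eqVneq (y :: w) [:: letter_inv a].
  by rewrite letter_invK eqxx.
by rewrite IH//= (negPf yl).
Qed.

(** Right translations are automorphisms of the tree, and they respect the
    orientation of every edge but the one from 1 to [letter_inv a]. *)
Lemma fg_word_mul_letter (w : Fd) (a l : letter) w' :
  fg_word w = l :: w' -> w != fg_letter (letter_inv a) ->
  fg_word (w * fg_letter a)%g = l :: fg_word (fg_parent w * fg_letter a)%g.
Proof.
move=> we wa; rewrite /= we /=; apply: push_wmul_letter.
  by rewrite -we; exact: fg_reduced.
by rewrite -we.
Qed.

Definition fg_enum (n : nat) : Fd := insubd (fg_one d) (odflt [::] (unpickle n)).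

Lemma fg_enumP : enumerates fg_enum.
Proof.
by move=> w; exists (pickle (fg_word w)); rewrite /fg_enum pickleK /= valKd.
Qed.

Definition parent_closed (F : seq Fd) := forall w, w \in F -> fg_parent w \in F.

(** The closure is obtained by adding all ancestors. *)
Lemma parent_closed_cofinal (F : seq Fd) :
  exists F', [/\ uniq F', parent_closed F' & {subset F <= F'}].
Proof.
pose anc (w : Fd) := [seq iter n fg_parent w | n <- iota 0 (size w).+1].
exists (undup (flatten [seq anc w | w <- F])); split; first exact: undup_uniq.
  move=> u; rewrite !mem_undup => /flatten_mapP[w wF /mapP[n]].
  rewrite mem_iota ltnS => /= nw ->; apply/flatten_mapP; exists w => //.
  rewrite -iterS; have [->|nw'] := eqVneq n (size w); last first.
    by apply/mapP; exists n.+1; rewrite // mem_iota ltnS ltn_neqAle nw'.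
  apply/mapP; exists (size w); first by rewrite mem_iota ltnS leqnn.
  have iter0 k : size (iter k fg_parent w) = (size w - k)%N.
    by elim: k => [|k IH]; rewrite ?subn0//= size_behead IH subnS.
  have i0 : fg_word (iter (size w) fg_parent w) = [::].
    by apply: size0nil; rewrite iter0 subnn.
  by apply: val_inj; rewrite /= i0.
move=> w wF; rewrite mem_undup; apply/flatten_mapP; exists w => //.
by apply/mapP; exists 0%N; rewrite ?mem_iota.
Qed.

End FreeGroupTree.

Section TreeChain.
Variables (R : realType) (d : nat) (E : pointedFinType).
Local Notation letter := ('I_d * bool)%type.
Local Notation Fd := (free_group d).
Variables (p : E -> R) (P : letter -> E -> E -> R).
Implicit Types (x y : config Fd E) (w : Fd).

(** The law of the state at [w] given the states at the other vertices of a set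
    closed under parents, from which [w] was absent; the root, which has no
    letter, is drawn from [p]. *)
Definition tree_kernel x w (k : E) : R :=
  if fg_word w is l :: _ then P l (x (fg_parent w)) k else p k.

Hypothesis p_ge0 : forall k, 0 <= p k.
Hypothesis p_sum : \sum_k p k = 1.
Hypothesis P_ge0 : forall l j k, 0 <= P l j k.
Hypothesis P_sum : forall l j, \sum_k P l j k = 1.

Lemma tree_kernel_ge0 x w k : 0 <= tree_kernel x w k.
Proof. by rewrite /tree_kernel; case: fg_word. Qed.

Lemma tree_kernel_sum x w : \sum_k tree_kernel x w k = 1.
Proof. by rewrite /tree_kernel; case: fg_word. Qed.

Definition update x w (k : E) : config Fd E :=
  fun v => if v == w then k else x v.

(** The expectation of [f] when the states at the vertices [ws] are redrawn one
    after the other by the kernel, starting from [x]. *)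
Fixpoint sample (ws : seq Fd) (f : config Fd E -> R) x : R :=
  if ws is w :: ws' then
    \sum_k tree_kernel x w k * sample ws' f (update x w k)
  else f x.

Lemma sample_ge0 ws f x : (forall y, 0 <= f y) -> 0 <= sample ws f x.
Proof.
move=> f0; elim: ws x => //= w ws IH x.
by apply: sumr_ge0 => k _; rewrite mulr_ge0// tree_kernel_ge0.
Qed.

Lemma sample_add ws f g h x : (forall y, h y = f y + g y) ->
  sample ws h x = sample ws f x + sample ws g x.
Proof.
move=> hfg; elim: ws x => [|w ws IH] x /=; first exact: hfg.
by rewrite -big_split; apply: eq_bigr => k _; rewrite IH mulrDr.
Qed.

Lemma sample1 ws x : sample ws (fun=> 1) x = 1.
Proof.
elim: ws x => //= w ws IH x; rewrite -[RHS](tree_kernel_sum x w).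
by apply: eq_bigr => k _; rewrite IH mulr1.
Qed.

Definition by_size : rel Fd := fun v w => (size (fg_word v) <= size (fg_word w))%N.

(** Sampling parents before children, a vertex of [F] contributes its transition
    probability and a vertex outside [F] contributes a sum equal to 1. The
    vertices of [F] that are not sampled must already agree with [x]. *)
Lemma sample_cyl ws F x y : sorted by_size ws -> uniq ws -> parent_closed F ->
  sample ws (\1_(cyl x F)) y =
  (all (fun w => (w \in ws) || (y w == x w)) F)%:R *
  \prod_(w <- ws | w \in F) tree_kernel x w (x w).
Proof.
move=> + + pF; elim: ws y => [|w ws IH] y /=.
  move=> _ _; rewrite big_nil mulr1 indicE; congr (_%:R); congr nat_of_bool.
  apply/idP/allP => [|yF]; first by rewrite inE => yx i iF /=; rewrite yx.
  by rewrite inE => i /yF /eqP.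
move=> pws /andP[wws uws].
have sws : sorted by_size ws := path_sorted pws.
have later v : v \in w :: ws -> (size (fg_word w) <= size (fg_word v))%N.
  rewrite inE => /predU1P[->//|]; move: v; apply/allP.
  by apply: order_path_min pws => u v t; exact: leq_trans.
under eq_bigr => k _ do rewrite IH// mulrA.
rewrite -mulr_suml big_cons; have [wF|wF] := boolP (w \in F); last first.
  congr (_ * _); transitivity (\sum_k tree_kernel y w k *
      (all (fun v => (v \in w :: ws) || (y v == x v)) F)%:R); last first.
    by rewrite -mulr_suml tree_kernel_sum mul1r.
  apply: eq_bigr => k _; congr (_ * _%:R); congr nat_of_bool.
  apply: eq_in_all => v vF; rewrite /update inE.
  by have /negPf-> : v != w by apply: contraNneq wF => <-.
rewrite mulrA; congr (_ * _).
rewrite (bigD1 (x w))//= big1 ?addr0 => [|k kx]; last first.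
  rewrite (_ : all _ _ = false) ?mulr0//; apply/negP => /allP /(_ w wF).
  by rewrite (negPf wws) /update eqxx /= (negPf kx).
rewrite (_ : all _ F = all (fun v => (v \in w :: ws) || (y v == x v)) F).
  case: allP => [yF|_]; last by rewrite mulr0 mul0r.
  rewrite mulr1 mul1r /tree_kernel; case we: (fg_word w) => [|l w'] //.
  have /orP[|/eqP->//] := yF _ (pF _ wF).
  by move/later; rewrite /= we /= ltnn.
apply: eq_in_all => v vF; rewrite /update inE.
by have [->|_ //] := eqVneq v w; rewrite eqxx orbT.
Qed.

(** The usual product formula for a Markov chain on a tree, the factor of the
    root included. *)
Definition tree_weight x (F : seq Fd) : R :=
  \prod_(w <- F) tree_kernel x w (x w).

(** Sampling more and more vertices stabilizes the probability of each cylinder,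
    so the limit measure exists and has the expected values. *)
Theorem tree_chain_exists : exists nu : probability (borel (config Fd E)) R,
  forall x F, uniq F -> parent_closed F -> nu (cyl x F) = (tree_weight x F)%:E.
Proof.
pose ws n := sort by_size (undup (mkseq (@fg_enum d) n)).
have ws_sorted n : sorted by_size (ws n).
  by apply: sort_sorted => v w; exact: leq_total.
have ws_uniq n : uniq (ws n) by rewrite sort_uniq undup_uniq.
pose m n (C : set (config Fd E)) := sample (ws n) (\1_C) point.
have [|||nu [nuE _]] := @limit_measure R Fd E _ (@fg_enumP d) m.
- by move=> n C _; apply: sample_ge0 => x; rewrite indicE ler0n.
- move=> n C D _ _ CD; apply: sample_add => x.
  rewrite !indicE in_setU; have [xC|xC] := boolP (x \in C).
    have /negPf-> : x \notin D; last by rewrite addr0.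
    apply/negP; rewrite inE => xD; suff : set0 x by [].
    by rewrite -CD; split=> //; rewrite inE in xC.
  by rewrite add0r.
- move=> n; rewrite -[RHS](sample1 (ws n) point).
  by rewrite /m; congr sample; apply/funext => x; rewrite indicE in_setT.
exists nu => x F uF pF; apply: nuE; first exact: finitary_cyl.
apply: filterS (enumerates_near (@fg_enumP d) F) => n Fn.
have Fws : {subset F <= ws n} by move=> w /Fn; rewrite mem_sort mem_undup.
rewrite /m sample_cyl// (_ : all _ F = true); last first.
  by apply/allP => w /Fws ->.
rewrite mul1r -big_filter; apply: perm_big; apply: uniq_perm => //.
  exact: filter_uniq.
by move=> w; rewrite mem_filter; case: (boolP (w \in F)) => //= /Fws.
Qed.

Hypothesis reversible : forall l j k, p j * P l j k = p k * P (letter_inv l) k j.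

Lemma parent_closed_shift (F : seq Fd) a :
  parent_closed F -> fg_letter (letter_inv a) \in F ->
  parent_closed [seq (w * fg_letter a)%g | w <- F].
Proof.
move=> pF aF _ /mapP[w wF ->].
have [->|wa] := eqVneq w (fg_letter (letter_inv a)).
  apply/mapP; exists (fg_letter (letter_inv a)) => //.
  by rewrite fg_letterKV; exact: val_inj.
case we: (fg_word w) => [|l w'].
  apply/mapP; exists (fg_letter (letter_inv a)) => //.
  rewrite fg_letterKV (_ : w = 1%g) ?mul1g; last exact: val_inj.
  exact: val_inj.
apply/mapP; exists (fg_parent w); first exact: pF.
by apply/val_inj; rewrite /= -[RHS]/(behead (l :: _)) -(fg_word_mul_letter we wa).
Qed.

(** The translation reverses one edge, the one between 1 and [letter_inv a];
    the product of the factors of its two ends is unchanged, by reversibility,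
    and the other factors correspond one to one. *)
Lemma tree_weight_shift (F : seq Fd) a y : uniq F -> parent_closed F ->
  fg_letter (letter_inv a) \in F ->
  tree_weight y [seq (w * fg_letter a)%g | w <- F] =
  tree_weight (shift_act (fg_letter a) y) F.
Proof.
set s := fg_letter a; set s' := fg_letter (letter_inv a).
move=> uF pF s'F; pose x := shift_act s y.
have oF : 1%g \in F.
  by have := pF _ s'F; rewrite (_ : fg_parent _ = 1%g)//; exact: val_inj.
(* the two ends of the reversed edge are treated apart *)
pose F0 := rem s' (rem 1%g F).
have s'1 : s' != 1%g by apply/eqP => /(congr1 (@fg_word d)).
have F0E : perm_eq F [:: 1%g, s' & F0].
  apply: perm_trans (perm_to_rem oF) _; rewrite perm_cons perm_to_rem//.
  by rewrite mem_rem_uniq// inE s'1.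
rewrite /tree_weight big_map !(perm_big _ F0E)/= !big_cons !mulrA; congr (_ * _).
  rewrite mul1g fg_letterKV /x /shift_act.
  have k1 z k : tree_kernel z 1%g k = p k by [].
  have kl z b k : tree_kernel z (fg_letter b) k = P b (z 1%g) k.
    by rewrite /tree_kernel /=; congr (P b (z _) k); exact: val_inj.
  by rewrite !k1 !kl !mul1g fg_letterKV mulrC reversible.
apply: eq_big_seq => w wF0.
have [w1 ws'] : w != 1%g /\ w != s'.
  have := perm_uniq F0E; rewrite uF /= inE negb_or => /esym.
  move=> /andP[/andP[_ oF0] /andP[s'F0 _]].
  by split; [apply: contraNneq oF0 => <-|apply: contraNneq s'F0 => <-].
rewrite {2}/tree_kernel; case we: (fg_word w) => [|l w'].
  by case/eqP: w1; exact: val_inj.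
have wse := fg_word_mul_letter we ws'.
rewrite /tree_kernel wse; congr (P l (y _) _).
by apply: val_inj; rewrite [LHS]/= -[LHS]/(behead (fg_word (w * s)%g)) wse.
Qed.

Theorem invariant_tree_chain :
  exists nu : probability (borel (config Fd E)) R, shift_invariant nu /\
    forall x F, uniq F -> parent_closed F ->
      nu (cyl x F) = (tree_weight x F)%:E.
Proof.
have [nu nuE] := tree_chain_exists; exists nu; split=> //.
have mS s : measurable_fun setT
    (shift_act s : borel (config Fd E) -> borel (config Fd E)).
  by apply: (@measurable_coordinatewise _ _ E E _ (fun t => t * s)%g
    (fun=> id) _ _ (@fg_enumP d)).
elim/fg_ind => [|a s IH] B mB.
  congr (nu _); apply/seteqP; split=> x /=; rewrite (_ : shift_act 1 x = x)//;
  by apply/funext => t; rewrite /shift_act mulg1.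
rewrite (_ : _ @^-1` _ = shift_act s @^-1` (shift_act (fg_letter a) @^-1` B)).
  have mB' : measurable
      (shift_act (fg_letter a) @^-1` B : set (borel (config Fd E))).
    by rewrite -[X in measurable X]setTI; exact: mS.
  rewrite IH//; have [nu' nu'E] := push_probability nu (mS (fg_letter a)).
  rewrite -nu'E; apply: (probability_eq_finitary (@fg_enumP d)) mB.
  pose s' := fg_letter (letter_inv a).
  apply: (@probability_eq_cyl _ _ _ _ _
    (fun F => [/\ uniq F, parent_closed F & s' \in F])).
    move=> F; have [F' [uF' pF' FF']] := parent_closed_cofinal (s' :: F).
    exists F'; split; first by split=> //; apply: FF'; rewrite mem_head.
    by move=> w wF; apply: FF'; rewrite inE wF orbT.
  move=> x F [uF pF s'F]; rewrite nu'E.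
  (* the only point whose shift is [x] *)
  pose y t := x (t * (fg_letter a)^-1)%g.
  rewrite (_ : _ @^-1` _ = cyl y [seq (w * fg_letter a)%g | w <- F]).
    rewrite nuE//; last exact: parent_closed_shift.
      rewrite tree_weight_shift// nuE//; congr (tree_weight _ _)%:E.
      by apply/funext => t; rewrite /shift_act /y mulgK.
    by rewrite map_inj_uniq//; exact: mulIg.
  apply/seteqP; split=> z zF.
    by move=> _ /mapP[w wF ->]; rewrite /y mulgK -(zF w wF).
  move=> w wF; rewrite /shift_act (zF (w * fg_letter a)%g) /y ?mulgK//.
  exact: map_f.
by apply/seteqP; split=> x /=; rewrite (_ : shift_act _ (shift_act s x) =
  shift_act (fg_letter a * s)%g x)//; apply/funext => t;
  rewrite /shift_act mulgA.
Qed.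

End TreeChain.

Lemma tree_weight_marginals (R : realType) (d : nat) (E : pointedFinType)
    (p : E -> R) (P : 'I_d * bool -> E -> E -> R)
    (nu : probability (borel (config (free_group d) E)) R) :
  (forall x F, uniq F -> parent_closed F ->
     nu (cyl x F) = (tree_weight p P x F)%:E) ->
  (forall j, nu [set z | z 1%g = j] = (p j)%:E) /\
  (forall l j k, nu [set z | z 1%g = j /\ z (fg_letter l) = k] =
     (p j * P l j k)%:E).
Proof.
move=> nuE; have par1 : fg_parent 1%g = 1%g :> free_group d by exact: val_inj.
split=> [j|l j k].
  have -> : [set z : config (free_group d) E | z 1%g = j] =
      cyl (fun=> j) [:: 1%g].
    by apply/seteqP; split=> z /=; [move=> zj i; rewrite inE => /eqP->|
      apply; rewrite mem_head].
  rewrite nuE//; first by rewrite /tree_weight big_seq1.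
  by move=> w; rewrite !inE => /eqP->; rewrite par1.
have l1 : fg_letter l != 1%g by apply/eqP => /(congr1 (@fg_word d)).
pose x t := if t == 1%g :> free_group d then j else k.
have -> : [set z : config (free_group d) E | z 1%g = j /\ z (fg_letter l) = k] =
    cyl x [:: 1%g; fg_letter l].
  apply/seteqP; split=> z /=.
    move=> [zj zk] i; rewrite !inE => /orP[]/eqP->; first by rewrite zj /x eqxx.
    by rewrite zk /x (negPf l1).
  by move=> zx; rewrite !zx ?inE ?eqxx ?orbT// /x eqxx (negPf l1).
have parl : fg_parent (fg_letter l) = 1%g by exact: val_inj.
rewrite nuE.
- rewrite /tree_weight !big_cons big_nil mulr1 /tree_kernel/= parl.
  by rewrite /x eqxx (negPf l1).
- by [].
- by move=> w; rewrite !in_cons in_nil orbF => /orP[]/eqP->; rewrite ?par1 ?parl.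
Qed.

Section CoupledChain.
Variables (R : realType) (d : nat) (E : pointedFinType).
Local Notation letter := ('I_d * bool)%type.
Variables (p : E -> R) (lam : letter -> E -> E -> R).
Hypothesis p_ge0 : forall k, 0 <= p k.
Hypothesis p_sum : \sum_k p k = 1.
Hypothesis lam_ge0 : forall l j k, 0 <= lam l j k.
Hypothesis lam_sum : forall l j, \sum_k lam l j k = p j.
Hypothesis lamV : forall l j k, lam l j k = lam (letter_inv l) k j.

(** The transitions of the chain are the couplings [lam] conditioned on the
    first state. States of probability zero have no conditional law; any
    transition from them does. *)
Corollary invariant_coupled_chain :
  exists nu : probability (borel (config (free_group d) E)) R,
  [/\ shift_invariant nu,
      forall j, nu [set z | z 1%g = j] = (p j)%:E &
      forall l j k,
        nu [set z | z 1%g = j /\ z (fg_letter l) = k] = (lam l j k)%:E].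
Proof.
(* [point] is an arbitrary target *)
pose P l j k : R := if p j == 0 then (k == point)%:R else lam l j k / p j.
have pP l j k : p j * P l j k = lam l j k.
  rewrite /P; case: eqVneq => [pj0|pj]; last by rewrite mulrC divfK.
  rewrite pj0 mul0r; apply/esym/eqP.
  have /eqP := lam_sum l j; rewrite pj0 psumr_eq0// => /allP/(_ k).
  by rewrite mem_index_enum => /(_ isT).
have P_ge0 l j k : 0 <= P l j k.
  by rewrite /P; case: ifP => _; rewrite ?ler0n// divr_ge0.
have P_sum l j : \sum_k P l j k = 1.
  rewrite /P; case: eqVneq => [_|pj]; last by rewrite -mulr_suml lam_sum divff.
  by rewrite (bigD1 point)//= eqxx big1 ?addr0// => k /negPf->.
have rev l j k : p j * P l j k = p k * P (letter_inv l) k j.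
  by rewrite !pP.
have [nu [inu nuE]] := invariant_tree_chain p_ge0 p_sum P_ge0 P_sum rev.
exists nu; have [nu1 nu2] := tree_weight_marginals nuE.
by split=> // l j k; rewrite nu2 pP.
Qed.

End CoupledChain.
HB.instance Definition _ (T : finType) (A : pointedFinType) :=
  isPointed.Build {ffun T -> A} [ffun=> point].

(** * Extending an invariant measure to the free group *)

Section Probability.
Context d (T : measurableType d) (R : realType) (mu : probability T R).

Lemma fineE B : measurable B -> (fine (mu B))%:E = mu B.
Proof. by move=> mB; rewrite fineK// fin_num_measure. Qed.

Lemma fine_sum_fibers (E : finType) (g : T -> E) (C : set T) :
  (forall a, measurable (g @^-1` [set a])) -> measurable C ->
  \sum_(a : E) fine (mu (C `&` g @^-1` [set a])) = fine (mu C).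
Proof.
move=> mg mC; apply: EFin_inj; rewrite fineE// (measure_sum_fibers _ mg mC).
by rewrite -sumEFin; apply: eq_bigr => a _; rewrite fineE//; exact: measurableI.
Qed.

Lemma measure_sub0 (B C : set T) : measurable B -> measurable C ->
  mu C = 0%E -> B `<=` C -> mu B = 0%E.
Proof. by move=> mB mC C0 BC; apply: (subset_measure0 mB mC BC). Qed.

Lemma measure_eq_off_null (I : choiceType) (F : seq I) (N : I -> set T)
    (B C : set T) :
  measurable B -> measurable C -> (forall i, measurable (N i)) ->
  (forall i, i \in F -> mu (N i) = 0%E) ->
  (forall x, (forall i, i \in F -> ~ N i x) -> B x <-> C x) -> mu B = mu C.
Proof.
move=> mB mC mN N0 BC.
pose U := \big[setU/set0]_(i <- F) N i.
have mU : measurable U by apply: bigsetU_measurable => i _.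
have U0 : mu U = 0%E.
  rewrite /U; elim: F N0 {BC U mU} => [|i F IH] N0; first by rewrite big_nil measure0.
  have mU' : measurable (\big[setU/set0]_(j <- F) N j).
    by apply: bigsetU_measurable => j _.
  rewrite big_cons setUC (measureU0 mU' (mN i) (N0 i (mem_head _ _))).
  by apply: IH => j jF; rewrite N0// inE jF orbT.
have NU x i : i \in F -> N i x -> U x.
  by move=> iF Nx; rewrite /U -bigcup_seq; exists i.
suff BU : B `|` U = C `|` U by rewrite -(measureU0 mB mU U0) BU measureU0.
apply/seteqP; split=> x [Bx|Ux]; try (by right);
  have [Ux|nUx] := pselect (U x); try (by right); left;
  by apply/BC => // i iF Nx; apply: nUx; exact: NU Nx.
Qed.

End Probability.

Lemma near_all_seq (I : eqType) (F : seq I) (Q : I -> nat -> Prop) :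
  (forall i, i \in F -> \forall n \near \oo, Q i n) ->
  \forall n \near \oo, forall i, i \in F -> Q i n.
Proof.
elim: F => [|i F IH] FQ; first by near=> n.
have Qi := FQ i (mem_head _ _).
have /IH QF j : j \in F -> \forall n \near \oo, Q j n.
  by move=> jF; apply: FQ; rewrite inE jF orbT.
near=> n => j; rewrite inE => /predU1P[->|]; first by near: n.
by move: j; near: n.
Unshelve. all: by end_near. Qed.

Section Windows.
Variables (R : realType) (d : nat) (Sigma : set (free_group d)).
Hypothesis hSigma : forall x, Sigma x ->
  exists i : 'I_d, x = fg_gen i \/ x = (fg_gen i)^-1%g.
Hypothesis hgen : forall i : 'I_d, Sigma (fg_gen i).
Local Notation letter := ('I_d * bool)%type.
Local Notation Fd := (free_group d).
Local Notation S := (submonoid Sigma).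

Definition gen_sub (i : 'I_d) : S :=
  incl_gen (exist (fun x => x \in Sigma) (fg_gen i) (mem_set (hgen i))).

Lemma val_gen_sub i : val (gen_sub i) = fg_letter (i, false).
Proof. by []. Qed.

(** The identity comes first so that every window contains it, at index
    [ord0]. *)
Definition sub_enum (n : nat) : S :=
  if n is k.+1 then insubd (1%g : S) (fg_enum d k) else 1%g.

Lemma sub_enumP : enumerates sub_enum.
Proof.
move=> s; have [k ks] := fg_enumP (val s).
by exists k.+1; rewrite /sub_enum ks valKd.
Qed.

Variables (A : pointedFinType) (mu : probability (borel (config S A)) R).
Hypothesis inv_mu : shift_invariant mu.

Definition window (n : nat) (x : config S A) : {ffun 'I_n.+1 -> A} :=
  [ffun j : 'I_n.+1 => x (sub_enum j)].

Lemma measurable_window n w :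
  measurable (@window n @^-1` [set w] : set (borel (config S A))).
Proof.
apply: finitary_measurable; exists (mkseq sub_enum n.+1) => x y xy /= <-.
by apply/ffunP => j; rewrite !ffunE xy//; exact: mem_mkseq_enum.
Qed.

Lemma measurable_shift (s : S) :
  measurable_fun setT (shift_act s : borel (config S A) -> borel (config S A)).
Proof.
by apply: (@measurable_coordinatewise _ _ A A _ (fun t => t * s)%g
  (fun=> id) _ _ sub_enumP).
Qed.

Lemma measurable_window_shift n s w :
  measurable ((@window n \o shift_act s) @^-1` [set w]
    : set (borel (config S A))).
Proof.
rewrite -[X in measurable X]setTI comp_preimage.
by apply: measurable_shift => //; exact: measurable_window.
Qed.

Local Notation win n := {ffun 'I_n.+1 -> A}.

Definition window_law n (w : win n) : R := fine (mu (@window n @^-1` [set w])).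

Definition window_pair n (i : 'I_d) (w w' : win n) : R :=
  fine (mu (@window n @^-1` [set w] `&`
            (@window n \o shift_act (gen_sub i)) @^-1` [set w'])).

(** The joint law of the windows of [x] and of [a_i x] on the edge of the
    generator [a_i], and its transpose on the edge of the inverse letter. *)
Definition window_coupling n (l : letter) (w w' : win n) : R :=
  if l.2 then window_pair l.1 w' w else window_pair l.1 w w'.

Lemma window_law_sum n : \sum_w window_law (w : win n) = 1.
Proof.
rewrite -[RHS]/(fine 1%:E) -(probability_setT mu).
rewrite -(fine_sum_fibers _ (@measurable_window n))//.
by apply: eq_bigr => w _; rewrite setTI.
Qed.

(** The second marginal of a coupling is the law of the window of [a_i x],
    which is that of [x] by invariance of [mu]. *)
Lemma window_coupling_sum n l (w : win n) :
  \sum_w' window_coupling l w w' = window_law w.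
Proof.
case: l => i [] /=; rewrite /window_coupling /window_pair /=; last first.
  apply: (fine_sum_fibers _ (measurable_window_shift _)).
  exact: measurable_window.
under eq_bigr do rewrite setIC.
rewrite (fine_sum_fibers _ (@measurable_window n)); last first.
  exact: measurable_window_shift.
rewrite /window_law comp_preimage; congr fine; apply: inv_mu.
exact: measurable_window.
Qed.

Lemma window_couplingV n l (w w' : win n) :
  window_coupling l w w' = window_coupling (letter_inv l) w' w.
Proof. by case: l => i []. Qed.

Lemma window_law_eq0 n (w : win n) (j j' : 'I_n.+1) :
  sub_enum j = sub_enum j' -> w j != w j' -> window_law w = 0.
Proof.
move=> jj' ww'; rewrite /window_law (_ : _ @^-1` _ = set0) ?measure0//.
rewrite -subset0 => x /= xw; move/eqP: ww'; apply.
by rewrite -xw !ffunE jj'.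
Qed.

(** The coupling is supported on pairs of windows of configurations [x] and
    [l x], and [(l x)(u) = x (u l)]. For [l] the inverse of [a_i] the roles are
    exchanged: [x] is [a_i] applied to the second configuration. *)
Lemma window_coupling_eq0 n (l : letter) (j j' : 'I_n.+1) (w w' : win n) :
  val (sub_enum j') = (val (sub_enum j) * fg_letter l)%g -> w' j != w j' ->
  window_coupling l w w' = 0.
Proof.
case: l => i b jj' ww'; rewrite /window_coupling /window_pair /=.
case: b jj' => jj'; rewrite (_ : _ `&` _ = set0) ?measure0//;
  rewrite -subset0 => x [/= xw xw']; move/eqP: ww'; apply.
  rewrite -xw -xw' !ffunE /shift_act; congr x; apply: val_inj.
  rewrite valM jj' -mulgA val_gen_sub.
  by rewrite (_ : fg_letter (i, true) * _ = 1)%g ?mulg1//; exact: fg_letterKV.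
rewrite -xw -xw' !ffunE /shift_act; congr x; apply: val_inj.
by rewrite valM jj'.
Qed.

Lemma window_chain_exists n :
  exists rho : probability (borel (config Fd (win n))) R,
  [/\ shift_invariant rho,
      forall w, rho [set z | z 1%g = w] = (window_law w)%:E &
      forall l w w', rho [set z | z 1%g = w /\ z (fg_letter l) = w'] =
        (window_coupling l w w')%:E].
Proof.
apply: invariant_coupled_chain => [w||l w w'|l w|l w w'].
- exact: fine_ge0.
- exact: window_law_sum.
- by rewrite /window_coupling; case: ifP => _; exact: fine_ge0.
- exact: window_coupling_sum.
- exact: window_couplingV.
Qed.

Definition window_chain n := sval (cid (window_chain_exists n)).

Lemma window_chain_inv n : shift_invariant (window_chain n).
Proof. by rewrite /window_chain; case: cid => rho []. Qed.

Lemma window_chain1 n w :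
  window_chain n [set z | z 1%g = w] = (window_law w)%:E.
Proof. by rewrite /window_chain; case: cid => rho []. Qed.

Lemma window_chain2 n l w w' :
  window_chain n [set z | z 1%g = w /\ z (fg_letter l) = w'] =
  (window_coupling l w w')%:E.
Proof. by rewrite /window_chain; case: cid => rho []. Qed.

(** In a configuration of windows, the window at [t'] predicts with its entry
    [j'] the entry [j] of the window at [t]; this is the event that it is
    wrong. *)
Definition mismatch n (t t' : Fd) (j j' : 'I_n.+1) :
    set (borel (config Fd (win n))) := [set z | z t j <> z t' j'].

Lemma measurable_mismatch n t t' (j j' : 'I_n.+1) :
  measurable (mismatch t t' j j').
Proof.
apply: finitary_measurable; exists [:: t; t'] => x y xy.
by rewrite /mismatch /= !xy// ?inE ?eqxx ?orbT.
Qed.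

Lemma mismatch_letter n l t (j j' : 'I_n.+1) :
  val (sub_enum j') = (val (sub_enum j) * fg_letter l)%g ->
  window_chain n (mismatch (fg_letter l * t)%g t j j') = 0%E.
Proof.
move=> jj'; have mM := measurable_mismatch (fg_letter l) 1%g j j'.
rewrite (_ : mismatch _ _ _ _ =
    shift_act t @^-1` mismatch (fg_letter l) 1%g j j'); last first.
  by apply/seteqP; split=> z; rewrite /mismatch /= /shift_act mul1g.
rewrite window_chain_inv//.
pose g (z : borel (config Fd (win n))) := (z 1%g, z (fg_letter l)).
have mg a : measurable (g @^-1` [set a]).
  apply: finitary_measurable; exists [:: 1%g; fg_letter l] => x y xy /= <-.
  by rewrite /g !xy ?inE ?eqxx ?orbT.
rewrite (measure_sum_fibers _ mg mM) big1// => -[w w'] _.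
have [ww'|ww'] := eqVneq (w' j) (w j').
  rewrite (_ : _ `&` _ = set0) ?measure0// -subset0 => z /= [].
  by rewrite /mismatch /= => + [z1 zl]; rewrite z1 zl.
have gE : g @^-1` [set (w, w')] = [set z | z 1%g = w /\ z (fg_letter l) = w'].
  by apply/seteqP; split=> z /=; [case=> -> ->|rewrite /g => -[-> ->]].
apply: (measure_sub0 (C := g @^-1` [set (w, w')])) => //.
- by apply: measurableI => //; exact: mg.
- by rewrite gE window_chain2 (window_coupling_eq0 jj' ww').
Qed.

Lemma mismatch_refl n (j j' : 'I_n.+1) : sub_enum j = sub_enum j' ->
  window_chain n (mismatch 1%g 1%g j j') = 0%E.
Proof.
move=> jj'; have mM := measurable_mismatch 1%g 1%g j j'.
pose g (z : borel (config Fd (win n))) := z 1%g.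
have mg a : measurable (g @^-1` [set a]) by exact: measurable_coord_fiber.
rewrite (measure_sum_fibers _ mg mM) big1// => w _.
have [ww'|ww'] := eqVneq (w j) (w j').
  rewrite (_ : _ `&` _ = set0) ?measure0// -subset0 => z /= [].
  by rewrite /mismatch /= => + z1; rewrite -/(g z) z1.
apply: (measure_sub0 (C := g @^-1` [set w])) => //.
- by apply: measurableI => //; exact: mg.
- by rewrite window_chain1 (window_law_eq0 jj' ww').
Qed.

Lemma sub_letter b : Sigma b -> exists l, b = fg_letter l.
Proof.
move=> /hSigma[i [->|->]]; first by exists (i, false).
by exists (i, true); exact: (fg_letterV (i, false)).
Qed.

(** Almost surely the window at 1 predicts the states at the elements of S:
    [z (b t) u = z t (u b)] for each letter, whence the claim by induction on
    the product, as soon as the windows are large enough to contain the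
    intermediate elements [u b]. *)
Lemma mismatch_products (bs : seq Fd) (u v : S) :
  (forall b, b \in bs -> Sigma b) -> val v = (val u * \prod_(b <- bs) b)%g ->
  exists N, forall n (j j' : 'I_n.+1), (N <= n)%N ->
    sub_enum j = u -> sub_enum j' = v ->
    window_chain n (mismatch (\prod_(b <- bs) b)%g 1%g j j') = 0%E.
Proof.
elim: bs u => [|b bs IH] u bsS vE.
  exists 0%N => n j j' _ ju jv; rewrite big_nil; apply: mismatch_refl.
  by rewrite ju jv; apply: val_inj; rewrite vE big_nil mulg1.
have bS : Sigma b by apply: bsS; rewrite mem_head.
have [l bl] := sub_letter bS.
pose ub : S := (u * incl_gen (exist (fun x => x \in Sigma) b (mem_set bS)))%g.
have ubE : val ub = (val u * b)%g by rewrite valM.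
have [k ku] := sub_enumP ub.
have [||N IHN] := IH ub.
- by move=> c cbs; apply: bsS; rewrite inE cbs orbT.
- by rewrite ubE -mulgA vE big_cons.
exists (maxn N k) => n j j'; rewrite geq_max => /andP[Nn kn] ju jv.
pose i : 'I_n.+1 := Ordinal (kn : (k < n.+1)%N).
have i0 := IHN n i j' Nn ku jv.
have l0 : window_chain n (mismatch (b * \prod_(b <- bs) b)%g
    (\prod_(b <- bs) b)%g j i) = 0%E.
  by rewrite bl; apply: mismatch_letter; rewrite -bl /= ku ju.
have mM := measurable_mismatch.
rewrite big_cons.
apply: (measure_sub0 (C := mismatch (b * \prod_(b <- bs) b)%g
    (\prod_(b <- bs) b)%g j i `|` mismatch (\prod_(b <- bs) b)%g 1%g i j')).
- exact: mM.
- by apply: measurableU; exact: mM.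
- by rewrite measureU0//; exact: mM.
move=> z; rewrite /mismatch /= => zz.
have [zE|] := pselect (z (b * \prod_(b <- bs) b)%g j = z (\prod_(b <- bs) b)%g i);
  [right|by left].
by rewrite -zE.
Qed.

Definition window_origin n (z : config Fd (win n)) : config Fd A :=
  fun t => z t ord0.

Lemma measurable_window_origin n : measurable_fun setT
  (@window_origin n : borel (config Fd (win n)) -> borel (config Fd A)).
Proof.
by apply: (@measurable_coordinatewise _ _ (win n) A _ id (fun _ w => w ord0)
  _ _ (@fg_enumP d)).
Qed.

(** Off the mismatches, the restriction to S of the read off configuration
    agrees, on the coordinates that [C] depends on, with the window at 1, whose
    law is that of a window of [mu]. *)
Lemma window_chain_restriction C : finitary C ->
  \forall n \near \oo, window_chain n
    ((restriction (val : S -> Fd) \o @window_origin n) @^-1` C) = mu C.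
Proof.
move=> [F dC].
pose Q (s : S) n := (forall j : 'I_n.+1, sub_enum j = s ->
    window_chain n (mismatch (val s) 1%g ord0 j) = 0%E) /\
  exists j : 'I_n.+1, sub_enum j = s.
have : \forall n \near \oo, forall s, s \in F -> Q s n.
  apply: near_all_seq => s _; have [bs bsS sE] := set_mem (valP s).
  have [|N NE] := @mismatch_products bs 1%g s bsS; first by rewrite mul1g.
  have [k ks] := sub_enumP s; exists (maxn N k) => // n /=.
  rewrite geq_max => /andP[Nn kn]; split.
    by move=> j js; rewrite sE; apply: NE.
  by exists (Ordinal (kn : (k < n.+1)%N)).
apply: filterS => n FQ.
pose idx (s : S) : 'I_n.+1 := odflt ord0 [pick j : 'I_n.+1 | sub_enum j == s].
have idxE s : s \in F -> sub_enum (idx s) = s.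
  move=> /FQ[_ [j js]]; rewrite /idx; case: pickP => [i /eqP//|/(_ j)].
  by rewrite js eqxx.
(* the configuration that a window shows, arbitrary out of sight *)
pose ext (w : win n) : config S A := fun s => w (idx s).
have fD : finitary [set z : config Fd (win n) | C (ext (z 1%g))].
  by exists [:: 1%g] => x y xy /=; rewrite xy ?mem_head.
have mC : measurable (C : set (borel (config S A))).
  by apply: finitary_measurable; exists F.
transitivity (window_chain n [set z | C (ext (z 1%g))]).
  apply: (measure_eq_off_null (F := F)
    (N := fun s => mismatch (val s) 1%g ord0 (idx s))).
  - apply: finitary_measurable.
    apply: (@finitary_preimage _ _ (win n) A _ val (fun _ w => w ord0)) => //.
    by exists F.
  - exact: finitary_measurable.
  - by move=> s; exact: measurable_mismatch.
  - by move=> s sF; apply: (FQ s sF).1; exact: idxE.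
  - move=> z zN; apply: (depends_onE dC) => s sF.
    by apply: contrapT; exact: zN.
pose g (z : borel (config Fd (win n))) := z 1%g.
have mg a : measurable (g @^-1` [set a]) by exact: measurable_coord_fiber.
rewrite (measure_sum_fibers _ mg); last exact: finitary_measurable.
rewrite (measure_sum_fibers _ (@measurable_window n) mC).
apply: eq_bigr => w _.
have extC x : window n x = w -> C x <-> C (ext w).
  move=> xw; apply: (depends_onE dC) => s sF.
  by rewrite /ext -xw ffunE idxE.
have [Cw|nCw] := pselect (C (ext w)).
  transitivity (window_chain n [set z | z 1%g = w]).
    congr (window_chain n _); apply/seteqP; split=> z /=; first by case.
    by rewrite /g => ->.
  rewrite window_chain1 /window_law fineE; last exact: measurable_window.
  congr (mu _); apply/seteqP; split=> x /=; last by case.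
  by move=> xw; split=> //; apply/extC.
rewrite [in LHS](_ : _ `&` _ = set0); last first.
  by rewrite -subset0 => z /= [+ zw]; rewrite -/(g z) zw.
rewrite [in RHS](_ : _ `&` _ = set0) ?measure0//.
by rewrite -subset0 => x /= [+ /extC xw] => /xw.
Qed.

(** The laws of the configurations read off the window chains are invariant,
    and each finitary event on S eventually has the right probability; both
    properties pass to the limit. *)
Theorem free_group_extensible : extensible (val : S -> Fd) mu.
Proof.
pose nu_ n := sval (cid (push_probability (window_chain n)
  (measurable_window_origin (n := n)))).
have nu_E n B : nu_ n B = window_chain n (@window_origin n @^-1` B).
  by rewrite /nu_; case: cid.
have mS s : measurable_fun setT
    (shift_act s : borel (config Fd A) -> borel (config Fd A)).
  by apply: (@measurable_coordinatewise _ _ A A _ (fun t => t * s)%g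
    (fun=> id) _ _ (@fg_enumP d)).
have nu_inv n : shift_invariant (nu_ n).
  move=> s B mB; rewrite !nu_E; apply: window_chain_inv.
  rewrite -[X in measurable X]setTI.
  by apply: (measurable_window_origin (n := n)).
have [|||nu [nu_lim nu_eq]] :=
  @limit_measure R Fd A _ (@fg_enumP d) (fun n C => fine (nu_ n C)).
- by move=> n C _; exact: fine_ge0.
- move=> n C D fC fD CD; rewrite measureU ?fineD//;
    by [exact: fin_num_measure|exact: finitary_measurable|
        apply: fin_num_measure; exact: finitary_measurable].
- by move=> n; rewrite probability_setT.
have mR : measurable_fun setT
    (restriction val : borel (config Fd A) -> borel (config S A)).
  by apply: (@measurable_coordinatewise _ _ A A _ val (fun=> id)
    _ _ sub_enumP).
exists nu; split.
  move=> s B mB; have [nu' nu'E] := push_probability nu (mS s).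
  rewrite -nu'E; apply: (probability_eq_finitary (@fg_enumP d)) mB => C fC.
  rewrite nu'E; apply: nu_eq => //.
    by apply: (@finitary_preimage _ _ A A _ (fun t => t * s)%g (fun=> id)).
  by apply: nearW => n; rewrite nu_inv//; exact: finitary_measurable.
move=> B mB; have [nu' nu'E] := push_probability nu mR.
rewrite /pushforward -nu'E; apply: (probability_eq_finitary sub_enumP) mB => C fC.
have mC : measurable (C : set (borel (config S A))) by exact: finitary_measurable.
rewrite nu'E -(fineE mu mC); apply: nu_lim.
  by apply: (@finitary_preimage _ _ A A _ val (fun=> id)).
by apply: filterS (window_chain_restriction fC) => n <-; rewrite nu_E.
Qed.

End Windows.

(** * Residual finiteness and the tree of the submonoid *)

(** A partial injection of a finite set extends to a permutation. Given an
    extension [s] of all pairs but [(a, b)], exchanging the values [s a] and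
    [b] adds this pair and disturbs no other. *)
Lemma extend_perm (T : finType) (ps : seq (T * T)) :
  (forall x y, x \in ps -> y \in ps -> (x.1 == y.1) = (x.2 == y.2)) ->
  exists s : {perm T}, forall x, x \in ps -> s x.1 = x.2.
Proof.
elim: ps => [|[a b] ps IH] psP; first by exists 1%g.
have [x y xps yps|s sP] := IH.
  by apply: psP; rewrite inE ?xps ?yps orbT.
exists (s * tperm (s a) b)%g => -[a' b']; rewrite permM inE.
have [[-> ->] _|_ /= ps'] := eqVneq (a', b') (a, b); first by rewrite tpermL.
have := psP _ _ (mem_head (a, b) ps) _; move/(_ (a', b')).
rewrite inE ps' orbT => /(_ isT) /= E; have /= s' := sP _ ps'.
have [aa|aa] := eqVneq a a'; first by rewrite aa s' tpermL; apply/eqP; rewrite -E aa.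
rewrite s' tpermD//; last by rewrite -E.
by rewrite -s' (inj_eq perm_inj).
Qed.

Section Residual.
Variable d : nat.
Local Notation letter := ('I_d * bool)%type.

Definition letter_perm (T : finType) (s : 'I_d -> {perm T}) (l : letter) :
  {perm T} := if l.2 then (s l.1)^-1%g else s l.1.

(** The first letter acts last, in accordance with the left action of letters on
    the tree: the states visited along the suffixes of [w], from the shortest
    to the longest. *)
Definition word_act (T : finType) (s : 'I_d -> {perm T}) (w : seq letter) k :=
  foldr (fun l k => letter_perm s l k) k w.

(** The points are the suffixes of [w], indexed by their length: the letter read
    at length [j] has to send [j] to [j.+1]. This prescribes a partial
    injection for each generator, a clash meaning that two consecutive letters
    are inverse to each other. *)
Lemma free_group_residual (w : seq letter) : reduced w ->
  exists s : 'I_d -> {perm 'I_(size w).+1}, word_act s w ord0 = ord_max.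
Proof.
move=> rw; set n := size w; pose u := rev w.
have su : size u = n by rewrite size_rev.
(* the prescription at length [j], for a generator or for its inverse *)
pose pr (j : nat) (b : bool) : 'I_n.+1 * 'I_n.+1 :=
  if b then (inord j.+1, inord j) else (inord j, inord j.+1).
case w0: w => [|l0 w'].
  by exists (fun=> 1%g); apply/ord_inj; rewrite /= /n w0.
(* the word is read from its last letter *)
pose c j := nth l0 u j.
have uP j : (j.+1 < n)%N -> c j.+1 != letter_inv (c j).
  move=> jn; have : reduced u.
    rewrite /reduced rev_sorted; apply: sub_sorted rw => x y.
    by apply: contraNneq => ->; rewrite letter_invK.
  move/(sortedP l0) => /(_ j); rewrite su => /(_ jn).
  by [].
have sE i : exists s : {perm 'I_n.+1}, forall j, (j < n)%N -> (c j).1 = i ->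
    s (pr j (c j).2).1 = (pr j (c j).2).2.
  have [x y|s sP] :=
      @extend_perm _ [seq pr j (c j).2 | j <- iota 0 n & (c j).1 == i].
    move=> /mapP[j]; rewrite mem_filter mem_iota /= => /andP[/eqP ji jn] ->.
    move=> /mapP[k]; rewrite mem_filter mem_iota /= => /andP[/eqP ki kn] ->.
    have clash a b : (a < n)%N -> (b < n)%N -> (c a).1 = (c b).1 ->
        (c a).2 = ~~ (c b).2 -> (a == b.+1) = false.
      move=> an bn c1 c2; apply/eqP => ab; have := uP b; rewrite -ab.
      move=> /(_ an)/eqP; apply; rewrite [LHS]surjective_pairing c1 c2.
      by rewrite /letter_inv.
    have inordE a b : (a <= n)%N -> (b <= n)%N ->
        (inord a == inord b :> 'I_n.+1) = (a == b).
      by move=> an bn; rewrite -(inj_eq val_inj) /= !inordK.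
    have jn' := ltnW jn; have kn' := ltnW kn.
    rewrite /pr; case cj: (c j).2; case ck: (c k).2; rewrite /= !inordE//.
    - by rewrite eq_sym clash ?ji ?ki ?cj ?ck// clash ?ji ?ki ?cj ?ck.
    - by rewrite clash ?ji ?ki ?cj ?ck// eq_sym clash ?ji ?ki ?cj ?ck.
  exists s => j jn ji; apply: sP; apply/mapP; exists j => //.
  by rewrite mem_filter ji eqxx mem_iota.
have [s sP] := choice sE; exists s.
have step j : (j < n)%N -> letter_perm s (c j) (inord j) = inord j.+1.
  move=> jn; have := sP _ j jn erefl; rewrite /letter_perm /pr.
  by case: (c j).2 => //= <-; rewrite permK.
suff H m : (m <= n)%N ->
    foldl (fun k l => letter_perm s l k) ord0 (take m u) = inord m.
  rewrite /word_act -w0 -foldl_rev -/u -[X in foldl _ _ X](take_size u) su H//.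
  by apply/ord_inj; rewrite inordK.
elim: m => [|m IH] mn; first by rewrite take0 /=; apply/ord_inj; rewrite inordK.
by rewrite (take_nth l0) ?su// foldl_rcons IH 1?ltnW// step.
Qed.

End Residual.

(** * The Cayley tree of the submonoid *)

Section SubmonoidTree.
Variables (d : nat) (Sigma : set (free_group d)).
Hypothesis hSigma : forall x, Sigma x ->
  exists i : 'I_d, x = fg_gen i \/ x = (fg_gen i)^-1%g.
Local Notation letter := ('I_d * bool)%type.
Local Notation Fd := (free_group d).
Local Notation S := (submonoid Sigma).

Lemma fg_letter_mulP (l : letter) (u v : Fd) : v = (fg_letter l * u)%g ->
  fg_word v = l :: fg_word u \/ fg_word u = letter_inv l :: fg_word v.
Proof.
move=> ->; rewrite /=; case: (fg_word u) => [|y w] /=; first by left.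
by case: eqVneq => [->|_]; [right|left].
Qed.

Lemma fg_parent_cons l (u v : Fd) :
  fg_word v = l :: fg_word u -> fg_parent v = u.
Proof. by move=> vu; apply: val_inj; rewrite /= vu. Qed.

(** Reducing a product only deletes letters. *)
Lemma sub_letters (s : S) l : l \in fg_word (val s) -> Sigma (fg_letter l).
Proof.
have [bs bsS ->] := set_mem (valP s).
elim: bs bsS => [|b bs IH] bsS; first by rewrite big_nil.
have bS := bsS _ (mem_head b bs); have [k bk] := sub_letter hSigma bS.
rewrite big_cons bk.
have [->|be] := fg_letter_mulP (erefl (fg_letter k * \prod_(b <- bs) b)%g).
  rewrite inE => /predU1P[->|lw]; first by rewrite -bk.
  by apply: IH lw => c cbs; apply: bsS; rewrite inE cbs orbT.
move=> lw; apply: IH; last by rewrite be inE lw orbT.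
by move=> c cbs; apply: bsS; rewrite inE cbs orbT.
Qed.

Lemma letters_sub (w : Fd) : (forall l, l \in fg_word w -> Sigma (fg_letter l)) ->
  exists s : S, val s = w.
Proof.
move=> wS; suff wP : w \in products Sigma.
  by exists (exist (fun x => x \in products Sigma) w wP).
rewrite inE; exists (map (@fg_letter d) (fg_word w)).
  by move=> _ /mapP[l lw ->]; exact: wS.
rewrite big_map; case: w {wS} => w /=; elim: w => [|l w IH] rw.
  by rewrite big_nil; exact: val_inj.
rewrite big_cons (@fg_parentM _ (FreeGroup rw) l w erefl) -(IH (path_sorted rw)).
by congr (_ * _)%g; exact: val_inj.
Qed.

Lemma sub_parent (s : S) : exists t : S, val t = fg_parent (val s).
Proof.
by apply: letters_sub => l /mem_behead; exact: sub_letters.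
Qed.

Lemma cayley_letter (s t : S) : cayley s t ->
  exists l, val t = (fg_letter l * val s)%g.
Proof.
move=> /asboolP[a]; have [l al] := sub_letter hSigma (set_valP a).
have valI (u : S) : val (incl_gen a * u)%g = (fg_letter l * val u)%g.
  by rewrite valM -al.
case=> [->|->]; first by exists l.
by exists (letter_inv l); rewrite valI mulgA fg_letterKV mul1g.
Qed.

Lemma cayley_walk_size (t : S) n : cayley_walk 1%g t n ->
  (size (fg_word (val t)) <= n)%N.
Proof.
move=> [p [pp <- <-]].
suff H (s : S) : path (@cayley _ Sigma) s p ->
    (size (fg_word (val (last s p))) <= size (fg_word (val s)) + size p)%N.
  exact: (H _ pp).
elim: p s {pp} => [|u p IH] s /=; first by rewrite addn0.
move=> /andP[/cayley_letter[l ul] /IH]; move/leq_trans; apply.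
rewrite addnS -addSn leq_add2r.
have [->//|->] := fg_letter_mulP ul.
by rewrite /= ltnW.
Qed.

Lemma cayley_walk_letters (t : S) : cayley_walk 1%g t (size (fg_word (val t))).
Proof.
move tn : (size (fg_word (val t))) => n; elim: n t tn => [|n IH] t tn.
  exists [::]; split=> //=.
  by apply: val_inj; apply: val_inj; rewrite /= (size0nil tn).
case tw: (fg_word (val t)) tn => [//|l w] /= [wn].
have [s sE] := sub_parent t.
have sw : fg_word (val s) = w by rewrite sE /= tw.
have := IH s; rewrite sw => /(_ wn)[p [pp lp sp]].
exists (rcons p t); rewrite rcons_path last_rcons size_rcons pp sp lp; split=> //=.
have lS : Sigma (fg_letter l) by apply: (sub_letters (s := t)); rewrite tw mem_head.
apply/asboolP; exists (exist (fun x => x \in Sigma) _ (mem_set lS)); left.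
by apply: val_inj; rewrite valM sE [LHS](fg_parentM tw).
Qed.

Lemma cayley_depthE (t : S) : cayley_depth t = size (fg_word (val t)).
Proof.
rewrite /cayley_depth; case: ex_minnP => n /asboolP nt nmin; apply/eqP.
rewrite eqn_leq cayley_walk_size// andbT.
by apply: nmin; apply/asboolP; exact: cayley_walk_letters.
Qed.

(** A path in the tree that starts at 1 meets the parent of each vertex that it
    visits before this vertex: a step either appends a child or goes back to
    the parent, which has been visited. *)
Lemma rooted_tree_parent_closed (F : seq S) :
  rooted_tree [set` F] -> parent_closed (map val F).
Proof.
move=> [_ F1 Fconn] _ /mapP[t tF ->].
have [p [pp pt pF]] := Fconn _ _ F1 tF.
(* [X] is the part of the path already visited, [s] its current end *)
suff H (X : seq S) (s : S) : s \in X -> parent_closed (map val X) ->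
    path (@cayley _ Sigma) s p -> parent_closed (map val (X ++ p)).
  have X1 : parent_closed (map val [:: 1%g : S]).
    by move=> w; rewrite !inE => /eqP->; apply/eqP; exact: val_inj.
  have tp : t \in 1%g :: p by rewrite -pt mem_last.
  have := H [:: 1%g] 1%g (mem_head _ _) X1 pp _ (map_f val tp).
  move=> /mapP[u up ->]; apply/map_f; move: up; rewrite /= inE.
  by move=> /predU1P[->//|/pF].
elim: p X s {pp pt pF} => [|u p IH] X s sX cX /=; first by rewrite cats0.
move=> /andP[/cayley_letter[l ul] pp].
rewrite -cat_rcons; apply: (IH _ u) => //; first by rewrite mem_rcons mem_head.
rewrite map_rcons => w; rewrite !mem_rcons !inE => /predU1P[->|/cX->]; last first.
  by rewrite orbT.
have sX' := map_f val sX; apply/orP; right.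
have [us|su] := fg_letter_mulP ul; first by rewrite (fg_parent_cons us).
by have := cX _ (cX _ sX'); rewrite (fg_parent_cons su).
Qed.

End SubmonoidTree.

(** * Restricting a chain on the free group to the submonoid *)

Section RestrictedChain.
Variables (R : realType) (d : nat) (Sigma : set (free_group d)).
Hypothesis hSigma : forall x, Sigma x ->
  exists i : 'I_d, x = fg_gen i \/ x = (fg_gen i)^-1%g.
Local Notation letter := ('I_d * bool)%type.
Local Notation Fd := (free_group d).
Local Notation S := (submonoid Sigma).
Variables (E : pointedFinType) (p : E -> R) (P : letter -> E -> E -> R).
Hypothesis p_gt0 : forall k, 0 < p k.
Hypothesis p_sum : \sum_k p k = 1.
Hypothesis P_ge0 : forall l j k, 0 <= P l j k.
Hypothesis P_sum : forall l j, \sum_k P l j k = 1.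
Variable nu : probability (borel (config Fd E)) R.
Hypothesis nu_inv : shift_invariant nu.
Hypothesis nuE : forall x F, uniq F -> parent_closed F ->
  nu (cyl x F) = (tree_weight p P x F)%:E.
Variable mu : probability (borel (config S E)) R.
Hypothesis muE : forall B, mu B = nu (restriction (val : S -> Fd) @^-1` B).

Definition spread (x : config S E) : config Fd E :=
  fun w => x (insubd (1%g : S) w).

Lemma spread_val x s : spread x (val s) = x s.
Proof. by rewrite /spread valKd. Qed.

Lemma restriction_cyl x (F : seq S) :
  restriction (val : S -> Fd) @^-1` cyl x F = cyl (spread x) (map val F).
Proof.
apply/seteqP; split=> y yx.
  by move=> _ /mapP[s sF ->]; rewrite spread_val -(yx s sF).
by move=> s sF; rewrite -[RHS]spread_val -yx//; exact: map_f.
Qed.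

Lemma restricted_chain_invariant : shift_invariant mu.
Proof.
move=> s B mB; rewrite !muE -[RHS](nu_inv (val s)).
  congr (nu _); apply/seteqP; split=> y /=;
  by rewrite (_ : restriction _ _ = shift_act s (restriction val y))//;
  apply/funext => t; rewrite /shift_act /restriction /= valM.
rewrite -[X in measurable X]setTI.
by apply: (@measurable_coordinatewise _ _ E E _ val (fun=> id) _ _
  (@sub_enumP _ Sigma)).
Qed.

(** Evaluating [tree_kernel] at the vertex [a], whose parent is 1, is a way to
    read the transition matrix of the letter [a]. *)
Definition sub_kernel (a : Sigma) (j k : E) : R :=
  tree_kernel p P (fun=> j) (val a) k.

Lemma tree_edge_word (T : set S) (e : S * Sigma) : tree_edges T e ->
  exists l, val e.2 = fg_letter l /\
    fg_word (val (incl_gen e.2 * e.1)%g) = l :: fg_word (val e.1).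
Proof.
case: e => t a [_ _] /=; rewrite !(cayley_depthE hSigma) => lt_ta.
have [l al] := sub_letter hSigma (set_valP a); exists l; split=> //.
have atE : val (incl_gen a * t)%g = (fg_letter l * val t)%g by rewrite valM -al.
have [//|ta] := fg_letter_mulP atE.
by move: lt_ta; rewrite ta /= ltnNge ltnW.
Qed.

(** Each vertex but the root is the far end of exactly one edge oriented away
    from the root, the one from its parent. *)
Lemma tree_edges_bij (T : set S) : T 1%g ->
  (forall t, T t -> exists2 s, T s & val s = fg_parent (val t)) ->
  set_bij (tree_edges T) (T `\ 1%g) (fun e => incl_gen e.2 * e.1)%g.
Proof.
move=> T1 Tpar; split.
- move=> e Te; split; first by case: Te.
  have [l [_ eE]] := tree_edge_word Te.
  by move=> e1; move: eE; rewrite e1.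
- move=> e e'; rewrite !inE => /tree_edge_word[l [al eE]].
  move=> /tree_edge_word[l' [al' eE']] ee'; move: eE'; rewrite -ee' eE.
  move=> -[ll' ww']; case: e e' al al' ww' {ee' eE} => t a [t' a'] /= al al' ww'.
  congr pair; first by apply/val_inj/val_inj.
  by apply: val_inj; apply: (etrans al); rewrite ll' -al'.
- move=> t [Tt t1]; have [s Ts sE] := Tpar t Tt.
  case tw: (fg_word (val t)) => [|l w].
    by case: t1; apply/val_inj/val_inj.
  have lS : Sigma (fg_letter l).
    by apply: (sub_letters hSigma (s := t)); rewrite tw mem_head.
  have tE : t = (incl_gen (exist (fun x => x \in Sigma) _ (mem_set lS)) * s)%g.
    by apply: val_inj; rewrite valM sE [LHS](fg_parentM tw).
  exists (s, exist (fun x => x \in Sigma) _ (mem_set lS)) => //.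
  split=> //=; first by rewrite -tE.
  by rewrite -tE !(cayley_depthE hSigma) sE /= tw /=.
Qed.

Lemma restricted_chain_markov : markov_measure mu.
Proof.
exists p, sub_kernel; split.
  split=> // [a k l|a k]; first by apply: tree_kernel_ge0 => // j; exact: ltW.
  exact: tree_kernel_sum.
move=> x T Ttree; have [Tfin T1 _] := Ttree.
have /finite_seqP[F0 TF0] := Tfin.
pose F := undup F0.
have TF : T = [set` F].
  by rewrite TF0; apply/seteqP; split=> s /=; rewrite mem_undup.
have uF : uniq F by exact: undup_uniq.
have pF : parent_closed (map val F).
  by apply: (rooted_tree_parent_closed hSigma); rewrite -TF.
have -> : cylinder x T = cyl x F by rewrite TF.
rewrite muE restriction_cyl nuE//; last by rewrite map_inj_uniq//; exact: val_inj.
congr EFin; rewrite /tree_weight big_map.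
have oF : 1%g \in F by move: T1; rewrite TF.
have x1 : spread x 1%g = x 1%g by exact: (spread_val x 1%g).
rewrite (bigD1_seq _ oF uF)/= x1; congr (_ * _).
rewrite -big_filter fsbig_seq; last exact: filter_uniq.
have -> : [set` [seq s <- F | s != 1%g]] = T `\ 1%g.
  apply/seteqP; split=> s; rewrite /= mem_filter TF /=.
    by move=> /andP[/eqP s1 sF].
  by move=> [sF /eqP s1]; rewrite sF s1.
rewrite (reindex_fsbig (fun e : S * Sigma => incl_gen e.2 * e.1)%g (tree_edges T)).
  apply: eq_fsbigr => e; rewrite inE => /tree_edge_word[l [al eE]].
  rewrite /sub_kernel al spread_val {1}/tree_kernel eE.
  by rewrite (fg_parent_cons eE) spread_val.
apply: tree_edges_bij => // t; rewrite TF /= => tF.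
by have /mapP[s sF ->] := pF _ (map_f val tF); exists s.
Qed.

Lemma restricted_chain_full : (forall l j k, 0 < P l j k) -> fully_supported mu.
Proof.
move=> P_gt0; rewrite /fully_supported -subTset => x _ U oU Ux.
have [F FU] := nbhs_finitary (open_nbhs_nbhs (conj oU Ux)).
have mcyl : measurable (cyl x F : set (borel (config S E))).
  by apply: finitary_measurable; exact: finitary_cyl.
apply: (@lt_le_trans _ _ (mu (cyl x F))); last first.
  by apply: le_measure; rewrite ?inE//; exact: sub_sigma_algebra.
rewrite muE restriction_cyl.
have [F' [uF' pF' FF']] := parent_closed_cofinal (map val F).
apply: (@lt_le_trans _ _ (nu (cyl (spread x) F'))).
  rewrite nuE// lte_fin; apply: prodr_gt0 => w _.
  by rewrite /tree_kernel; case: fg_word.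
apply: le_measure; rewrite ?inE; try by apply: finitary_measurable; exact: finitary_cyl.
by move=> y yx w /FF'; exact: yx.
Qed.

End RestrictedChain.

(** * Noisy permutations *)

HB.instance Definition _ (n : nat) := isPointed.Build 'I_n.+1 ord0.

Lemma morph_mul1 (M : monoidType) (H : groupType) (f : M -> H) :
  {morph f : u v / (u * v)%g} -> f 1%g = 1%g.
Proof. by move=> fM; apply: (mulgI (f 1%g)); rewrite -fM !mulg1. Qed.

Section NoisyPermutations.
Variables (R : realType) (d : nat) (Sigma : set (free_group d)).
Hypothesis hSigma : forall x, Sigma x ->
  exists i : 'I_d, x = fg_gen i \/ x = (fg_gen i)^-1%g.
Hypothesis hgen : forall i : 'I_d, Sigma (fg_gen i).
Local Notation letter := ('I_d * bool)%type.
Local Notation Fd := (free_group d).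
Local Notation S := (submonoid Sigma).
Variables (n : nat) (s : 'I_d -> {perm 'I_n.+1}).
Local Notation E := 'I_n.+1.

Lemma letter_perm_inv l j k :
  (k == letter_perm s l j) = (j == letter_perm s (letter_inv l) k).
Proof.
case: l => i [] /=; rewrite /letter_perm /=.
  by rewrite -(inj_eq (@perm_inj _ (s i))) permKV eq_sym.
by rewrite -[RHS](inj_eq (@perm_inj _ (s i))) permKV eq_sym.
Qed.

Let N : R := n.+1%:R.
Let N_gt0 : 0 < N. Proof. by rewrite ltr0n. Qed.
Let N_neq0 : N != 0. Proof. exact: lt0r_neq0. Qed.

(** Below 1 / (n N), where N = n + 1 is the number of states, so that n slips
    are less likely than any given state. *)
Definition noise : R := N^-1 * N^-1.

Lemma noise_gt0 : 0 < noise.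
Proof. by rewrite mulr_gt0// invr_gt0. Qed.

Lemma noise_le1 : noise <= 1.
Proof. by rewrite mulr_ile1 ?invr_ge0 ?invf_le1 ?ler1n ?ltW. Qed.

Definition uniform_law (k : E) : R := N^-1.

Definition noisy_perm (l : letter) (j k : E) : R :=
  (1 - noise) * (k == letter_perm s l j)%:R + noise / N.

Lemma uniform_law_sum : \sum_k uniform_law k = 1.
Proof. by rewrite sumr_const card_ord -mulr_natl mulfV. Qed.

Lemma noisy_perm_gt0 l j k : 0 < noisy_perm l j k.
Proof.
apply: ltr_wpDl; last by rewrite divr_gt0 ?noise_gt0.
by rewrite mulr_ge0 ?ler0n// subr_ge0 noise_le1.
Qed.

Lemma noisy_perm_sum l j : \sum_k noisy_perm l j k = 1.
Proof.
rewrite big_split/= -mulr_sumr (bigD1 (letter_perm s l j))//= eqxx.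
rewrite big1 => [|k /negPf->//].
have -> : \sum_(k : E) noise / N = N * (noise / N).
  by rewrite sumr_const card_ord mulr_natl.
by rewrite mulrCA divff// !mulr1 addr0 mulr1 subrK.
Qed.

Lemma noisy_perm_reversible l j k : uniform_law j * noisy_perm l j k =
  uniform_law k * noisy_perm (letter_inv l) k j.
Proof. by rewrite /noisy_perm letter_perm_inv. Qed.

(** There are [N * N] pairs of states, each of probability [noise / N ^ 2]
    if it is a slip. *)
Lemma slip_bound (nu : probability (borel (config Fd E)) R) l :
  (forall j k, nu [set z | z 1%g = j /\ z (fg_letter l) = k] =
     (uniform_law j * noisy_perm l j k)%:E) ->
  (nu [set z | z (fg_letter l) <> letter_perm s l (z 1%g)] <= noise%:E)%E.
Proof.
move=> nu2; set M := [set z | _].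
have fM : finitary M.
  exists [:: 1%g; fg_letter l] => x y xy.
  by rewrite /M /= !xy ?inE ?eqxx ?orbT.
pose g (z : borel (config Fd E)) := (z 1%g, z (fg_letter l)).
have mg a : measurable (g @^-1` [set a]).
  apply: finitary_measurable; exists [:: 1%g; fg_letter l] => x y xy /= <-.
  by rewrite /g !xy ?inE ?eqxx ?orbT.
rewrite (measure_sum_fibers _ mg (finitary_measurable fM)).
apply: (@le_trans _ _ (\sum_(a : E * E) (N^-1 * (noise / N))%:E)%E); last first.
  rewrite sumEFin lee_fin sumr_const card_prod card_ord -mulr_natl natrM -/N.
  by rewrite le_eqVlt; apply/orP; left; apply/eqP; field.
apply: lee_sum => -[j k] _.
have gE : g @^-1` [set (j, k)] = [set z | z 1%g = j /\ z (fg_letter l) = k].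
  by apply/seteqP; split=> z /=; [case=> -> ->|rewrite /g => -[-> ->]].
have [kj|kj] := eqVneq k (letter_perm s l j).
  rewrite (_ : _ `&` _ = set0) ?measure0.
    by rewrite lee_fin ltW// mulr_gt0 ?divr_gt0 ?invr_gt0 ?noise_gt0.
  by rewrite gE -subset0 => z [Mz [z1 zl]]; apply: Mz; rewrite z1 zl.
apply: (@le_trans _ _ (nu (g @^-1` [set (j, k)]))).
  apply: le_measure; rewrite ?inE; [|exact: mg|by move=> z []].
  by apply: measurableI; [exact: finitary_measurable|exact: mg].
by rewrite gE nu2 lee_fin /noisy_perm (negPf kj) mulr0 add0r.
Qed.

Theorem noisy_markov_exists : exists mu : probability (borel (config S E)) R,
  [/\ shift_invariant mu, markov_measure mu, fully_supported mu,
      mu [set x | x 1%g = ord0] = (N^-1)%:E &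
      forall i, (mu [set x | x (gen_sub hgen i) <> s i (x 1%g)] <=
        noise%:E)%E].
Proof.
have u_gt0 k : 0 < uniform_law k by rewrite invr_gt0.
have P_ge0 l j k := ltW (noisy_perm_gt0 l j k).
have [nu [nu_inv nuE]] := invariant_tree_chain (E := E)
  (fun k => ltW (u_gt0 k)) uniform_law_sum P_ge0 noisy_perm_sum
  noisy_perm_reversible.
have mR : measurable_fun setT
    (restriction val : borel (config Fd E) -> borel (config S E)).
  by apply: (@measurable_coordinatewise _ _ E E _ val (fun=> id)
    _ _ (@sub_enumP _ Sigma)).
have [mu muE] := push_probability nu mR.
have [nu1 nu2] := tree_weight_marginals nuE.
exists mu; split.
- exact: restricted_chain_invariant nu_inv _ muE.
- exact: restricted_chain_markov u_gt0 uniform_law_sum P_ge0 noisy_perm_sum _ nuE _ muE.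
- exact: restricted_chain_full u_gt0 _ nuE _ muE noisy_perm_gt0.
- by rewrite muE nu1.
- by move=> i; rewrite muE; exact: (slip_bound (l := (i, false))).
Qed.

Variables (G : groupType) (theta : Fd -> G).
Hypothesis thetaM : {morph theta : u v / (u * v)%g}.

(** The state fails to follow the permutation along the edge of the letter [l]
    at the vertex [h]. *)
Definition slip (l : letter) (h : G) : set (borel (config G E)) :=
  [set y | y (theta (fg_letter l) * h)%g <> letter_perm s l (y h)].

Variable nubar : probability (borel (config G E)) R.
Hypothesis nubar_inv : shift_invariant nubar.
Hypothesis slip1 : forall i, (nubar (slip (i, false) 1%g) <= noise%:E)%E.

Lemma measurable_slip l h : measurable (slip l h).
Proof.
apply: finitary_measurable; exists [:: h; (theta (fg_letter l) * h)%g] => x y xy.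
by rewrite /slip /= !xy ?inE ?eqxx ?orbT.
Qed.

(** By invariance the vertex is irrelevant, and a slip along the inverse of a
    generator is a slip along the generator, seen from the other end. *)
Lemma slip_le l h : (nubar (slip l h) <= noise%:E)%E.
Proof.
have slip_gen i g : (nubar (slip (i, false) g) <= noise%:E)%E.
  have := slip1 i; rewrite -(nubar_inv g); last exact: measurable_slip.
  congr (nubar _ <= _)%E; apply/seteqP; split=> y;
    by rewrite /slip /= /shift_act mul1g mulg1.
case: l => i []; last exact: slip_gen.
have hE : h = (theta (fg_letter (i, false)) *
               (theta (fg_letter (i, true)) * h))%g.
  have := fg_letterKV (i, true); rewrite /letter_inv /= => i1.
  by rewrite mulgA -thetaM i1 (morph_mul1 thetaM) mul1g.
have := slip_gen i (theta (fg_letter (i, true)) * h)%g.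
congr (nubar _ <= _)%E; apply/seteqP; split=> y;
  rewrite /slip /= -hE /letter_perm /= => yh yh'; apply: yh.
  by rewrite yh' permKV.
by rewrite yh' permK.
Qed.

Definition word_eval (u : seq letter) : Fd :=
  foldr (fun l g => fg_letter l * g)%g 1%g u.

Lemma word_evalK (w : Fd) : word_eval (fg_word w) = w.
Proof.
case: w => w; elim: w => [|l w IH] rw /=; first exact: val_inj.
rewrite -/(word_eval w) (IH (path_sorted rw)).
by rewrite [RHS](@fg_parentM _ (FreeGroup rw) l w erefl); congr (_ * _)%g; exact: val_inj.
Qed.

Lemma word_slip_le (u : seq letter) :
  (nubar [set y | y (theta (word_eval u)) <> word_act s u (y 1%g)] <=
   ((size u)%:R * noise)%:E)%E.
Proof.
have mW v : measurable ([set y | y (theta (word_eval v)) <>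
    word_act s v (y 1%g)] : set (borel (config G E))).
  apply: finitary_measurable; exists [:: 1%g; theta (word_eval v)] => x y xy /=.
  by rewrite !xy ?inE ?eqxx ?orbT.
elim: u => [|l u IH] /=.
  rewrite mul0r (_ : [set _ | _] = set0) ?measure0// -subset0 => y /=.
  by rewrite (morph_mul1 thetaM).
rewrite -/(word_eval u) -/(word_act s u) thetaM.
apply: (@le_trans _ _ (nubar (slip l (theta (word_eval u)) `|`
    [set y | y (theta (word_eval u)) <> word_act s u (y 1%g)]))).
  apply: le_measure; rewrite ?inE.
  - by have := mW (l :: u); rewrite /= thetaM.
  - by apply: measurableU => //; exact: measurable_slip.
  - move=> y /= yl; have [yu|] := pselect (y (theta (word_eval u)) =
      word_act s u (y 1%g)); [left|by right].
    by rewrite /slip /= yu.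
apply: le_trans (measureU2 _ (measurable_slip _ _) (mW u)) _.
rewrite -natr1 mulrDl mul1r addrC EFinD.
by apply: leeD => //; exact: slip_le.
Qed.

End NoisyPermutations.

(** * Receiving groups *)

Section ReceivingGroup.
Variables (R : realType) (d : nat) (Sigma : set (free_group d)).
Hypothesis hSigma : forall x, Sigma x ->
  exists i : 'I_d, x = fg_gen i \/ x = (fg_gen i)^-1%g.
Hypothesis hgen : forall i : 'I_d, Sigma (fg_gen i).
Local Notation Fd := (free_group d).
Local Notation S := (submonoid Sigma).
Variables (G : groupType) (eta : S -> G).
Hypothesis hG : receiving_group eta.

Lemma receiving_morph1 : eta 1%g = 1%g.
Proof. by have [_ etaM _] := hG; exact: morph_mul1. Qed.

(** The free group maps to [G] by the values of [eta] on the generators. This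
    agrees with [eta] on an inverse of a generator that belongs to S because a
    morphism of monoids into a group preserves existing inverses. *)
Lemma free_group_to_receiving : exists theta : Fd -> G,
  {morph theta : u v / (u * v)%g} /\ forall t : S, theta (val t) = eta t.
Proof.
have [_ etaM _] := hG.
have [theta [[thM thg] _]] := free_group_univ (fun i => eta (gen_sub hgen i)).
exists theta; split=> // t; have th1 := morph_mul1 thM.
have [bs bsS tE] := set_mem (valP t).
elim: bs bsS t tE => [|b bs IH] bsS t tE.
  rewrite tE big_nil th1 -receiving_morph1; congr eta; apply: val_inj.
  by rewrite tE big_nil.
have bS : Sigma b by apply: bsS; rewrite mem_head.
have bsS' c : c \in bs -> Sigma c by move=> cbs; apply: bsS; rewrite inE cbs orbT.
have uP : (\prod_(c <- bs) c)%g \in products Sigma by rewrite inE; exists bs.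
pose u : S := exist (fun x => x \in products Sigma) _ uP.
pose a : S := incl_gen (exist (fun x => x \in Sigma) b (mem_set bS)).
have -> : t = (a * u)%g by apply: val_inj; rewrite valM tE big_cons.
rewrite valM thM etaM (IH bsS' u erefl); congr (_ * _)%g.
have [i [bi|bi]] := hSigma bS.
  have -> : a = gen_sub hgen i by apply: val_inj.
  by rewrite -thg.
apply: (mulIg (eta (gen_sub hgen i))); rewrite -etaM -thg -thM.
have -> : val a = (fg_gen i)^-1%g by [].
rewrite mulVg th1 -receiving_morph1; congr eta; apply: val_inj.
by rewrite valM /= bi mulVg.
Qed.

Lemma free_group_onto_receiving (theta : Fd -> G) :
  {morph theta : u v / (u * v)%g} -> (forall t : S, theta (val t) = eta t) ->
  forall g, exists w, theta w = g.
Proof.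
move=> thM thE; have [_ _ Ggen] := hG; have th1 := morph_mul1 thM.
(* the image of [theta] is a subgroup that contains that of [eta] *)
pose H : {pred G} := fun g => `[< exists w, theta w = g >].
have HP g : g \in H <-> exists w, theta w = g by split=> /asboolP.
move=> g; apply/HP; apply: Ggen => [|t]; last by apply/HP; exists (val t).
split; first by apply/HP; exists 1%g.
move=> _ _ /HP[u <-] /HP[v <-]; apply/HP; exists (u * v^-1)%g.
by apply: (mulIg (theta v)); rewrite -thM !mulgVK.
Qed.

Lemma extensible_of_iso (A : pointedFinType)
    (mu : probability (borel (config S A)) R) :
  sgroup_isomorphic eta (val : S -> Fd) -> shift_invariant mu ->
  extensible eta mu.
Proof.
move=> [theta [thM [thi thiK thK] thE]] mu_inv.
have [nu [nu_inv nu_mu]] := free_group_extensible hSigma hgen mu_inv.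
pose psi (y : config Fd A) : config G A := fun g => y (theta g).
have mpsi : measurable_fun setT
    (psi : borel (config Fd A) -> borel (config G A)).
  apply: (@measurable_coordinatewise _ _ A A psi theta (fun=> id) _
    (thi \o @fg_enum d)) => // g.
  by have [k kg] := fg_enumP (theta g); exists k; rewrite /= kg thiK.
have [nu' nu'E] := push_probability nu mpsi.
exists nu'; split=> [g B mB|B mB].
  rewrite !nu'E -[RHS](nu_inv (theta g)).
    by congr (nu _); apply/seteqP; split=> y;
       rewrite /= (_ : shift_act g _ = psi (shift_act (theta g) y))//;
       apply/funext => h; rewrite /psi /shift_act thM.
  by rewrite -[X in measurable X]setTI; exact: mpsi.
rewrite /pushforward nu'E -(nu_mu B mB) /pushforward.
by congr (nu _); apply/seteqP; split=> y;
   rewrite /= (_ : restriction eta _ = restriction val y)//;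
   apply/funext => t; rewrite /restriction /= /psi -thE.
Qed.

(** The measure of noisy permutations in which [w] moves the state 0. If it
    extends to [G], then the state at [theta w = 1] is moved by [w] up to
    slips, so one slip at least occurs when the state at 1 is 0. *)
Lemma not_extensible_of_kernel (theta : Fd -> G) (w : Fd) :
  {morph theta : u v / (u * v)%g} -> (forall t : S, theta (val t) = eta t) ->
  theta w = 1%g -> w != 1%g ->
  exists (A : pointedFinType) (mu : probability (borel (config S A)) R),
    [/\ shift_invariant mu, markov_measure mu, fully_supported mu &
        ~ extensible eta mu].
Proof.
move=> thM thE w1 wn1.
have [s sw] := free_group_residual (fg_reduced w).
set n := size (fg_word w) in s sw *.
have n_gt0 : (0 < n)%N.
  by rewrite lt0n size_eq0; apply: contraNneq wn1 => /= w0; apply/eqP/val_inj.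
have [mu [mu_inv mu_markov mu_full mu0 mu_slip]] :=
  noisy_markov_exists R hSigma hgen s.
exists 'I_n.+1, mu; split=> // -[nubar [nubar_inv nubar_mu]].
have slip1 i : (nubar (slip s theta (i, false) 1%g) <= (noise R n)%:E)%E.
  apply: le_trans (mu_slip i); rewrite -nubar_mu; last first.
    apply: finitary_measurable; exists [:: 1%g; gen_sub hgen i] => x y xy /=.
    by rewrite !xy ?inE ?eqxx ?orbT.
  rewrite /pushforward (_ : _ @^-1` _ = slip s theta (i, false) 1%g)//.
  by apply/seteqP; split=> y; rewrite /slip /= /restriction /=
    -thE receiving_morph1 mulg1.
have := word_slip_le thM nubar_inv slip1 (fg_word w).
rewrite word_evalK w1 -/n; apply/negP; rewrite -ltNge.
apply: (@lt_le_trans _ _ (nubar [set y | y 1%g = ord0])).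
  have -> : nubar [set y | y 1%g = ord0] = (n.+1%:R^-1)%:E.
    rewrite -mu0 -nubar_mu; last first.
      apply: finitary_measurable; exists [:: 1%g] => x y xy /=.
      by rewrite xy ?mem_head.
    by rewrite /pushforward; congr (nubar _); apply/seteqP; split=> y;
      rewrite /= /restriction /= receiving_morph1.
  rewrite lte_fin /noise mulrA gtr_pMl ?invr_gt0 ?ltr0n//.
  by rewrite ltr_pdivrMr ?ltr0n// mul1r ltr_nat.
apply: le_measure; rewrite ?inE.
- apply: finitary_measurable; exists [:: 1%g] => x y xy /=.
  by rewrite xy ?mem_head.
- apply: finitary_measurable; exists [:: 1%g] => x y xy /=.
  by rewrite xy ?mem_head.
- move=> y /= ->; rewrite sw => /(congr1 val) /= n0.
  by rewrite -n0 in n_gt0.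
Qed.

Lemma iso_of_extensible :
  (forall (A : pointedFinType) (mu : probability (borel (config S A)) R),
     shift_invariant mu -> markov_measure mu -> fully_supported mu ->
     extensible eta mu) ->
  sgroup_isomorphic eta (val : S -> Fd).
Proof.
move=> ext; have [theta [thM thE]] := free_group_to_receiving.
have th_surj := free_group_onto_receiving thM thE.
have ker1 w : theta w = 1%g -> w = 1%g.
  move=> w1; apply/eqP/negPn/negP => wn1.
  have [A [mu [inv mk full next]]] := not_extensible_of_kernel thM thE w1 wn1.
  by apply: next; exact: ext.
have th_inj : injective theta.
  move=> u v uv; apply: (mulIg v^-1%g); rewrite mulgV; apply: ker1.
  by rewrite thM uv -thM mulgV (morph_mul1 thM).
have [thi thiK] := choice th_surj.
exists thi; split.
- by move=> g h; apply: th_inj; rewrite thM !thiK.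
- by exists theta => // w; apply: th_inj; rewrite thiK.
- by move=> t; apply: th_inj; rewrite thiK thE.
Qed.

End ReceivingGroup.

Theorem theoremE (R : realType) (d : nat) (hd : (0 < d)%N)
  (Sigma : set (free_group d))
  (hSigma : forall x, Sigma x ->
     exists i : 'I_d, x = fg_gen i \/ x = (fg_gen i)^-1%g)
  (hgen : forall i : 'I_d, Sigma (fg_gen i))
  (G : groupType) (eta : submonoid Sigma -> G)
  (hG : receiving_group eta) :
  [<-> sgroup_isomorphic eta (val : submonoid Sigma -> free_group d);
       forall (A : pointedFinType)
              (mu : probability (borel (config (submonoid Sigma) A)) R),
         shift_invariant mu -> extensible eta mu;
       forall (A : pointedFinType)
              (mu : probability (borel (config (submonoid Sigma) A)) R),
         shift_invariant mu -> markov_measure mu -> fully_supported mu ->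
         extensible eta mu].
Proof.
tfae=> [iso A mu|ext A mu mu_inv _ _|ext].
- exact: extensible_of_iso.
- exact: ext.
- exact: iso_of_extensible ext.
Qed.
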